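(* (i) For all integers $n\ge1$, complex $q\neq1$ and $\beta\notin\{1,q^{-1},\ldots\}$, $$0=\sum_{k=0}^n\begin{bmatrix}n\\ k\end{bmatrix}_q\begin{bmatrix}n+k\\ k\end{bmatrix}_qq^k\beta^{n-k}(\beta/q)_k(q/\beta)_{n-k}\frac{1-\beta q^{2k}}{(\beta q^k)_{n+1}(1-q^{k+1})},$$ $$0=\sum_{k=0}^n\begin{bmatrix}2n+1\\ n-k\end{bmatrix}_q\beta^kq^{n-k}(q/\beta)_k(\beta/q)_{n-k}(1-q^{2k+1})(\beta q^{k+1})_{n-1}.$$ (ii) For $|q|,|\beta|<1$, $$\frac{(q\beta^2|q^2)_\infty(-q)_\infty(q^2|q^2)_\infty}{(\beta^2|q^2)_\infty}=\sum_{n\ge0}(-1)^n\frac{\beta^n(q/\beta)_n}{(\beta)_{n+1}},$$ $$\frac{(\beta^2|q^2)_\infty(1-\beta)^2}{(q\beta^2|q^2)_\infty(-q)_\infty(q^2|q^2)_\infty(1-q)}=\sum_{n\ge0}(-1)^n\frac{q^n(\beta/q)_n(\beta)_n(q|q^2)_n(1-\beta q^{2n})}{(q)_n(q)_{n+1}(\beta^2q|q^2)_n},$$ $$\frac{(\beta^2)_\infty(q)_\infty^3}{(\beta)_\infty^4}=\sum_{n\ge0}(2n+1)\frac{\beta^n(q/\beta)_n}{(\beta)_{n+1}} .$$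
   Context: $(a|q)_n=\prod_{j=0}^{n-1}(1-aq^j)$, $(a|q)_\infty=\prod_{j\ge0}(1-aq^j)$; $(a)_n$ abbreviates $(a|q)_n$ (also for $n=\infty$). $\begin{bmatrix}n\\ k\end{bmatrix}_q$ is the Gauss ($q$-binomial) polynomial, equal to $\frac{(q)_n}{(q)_k(q)_{n-k}}$ when the denominator does not vanish. Products such as $\beta^n(q/\beta)_n=\prod_{i=0}^{n-1}(\beta-q^{i+1})$ and $q^n(\beta/q)_n=\prod_{i=0}^{n-1}(q-\beta q^i)$ are read as polynomials; the finite identities are identities of rational functions, read where their denominators do not vanish.
   Formalization: In the second identity of (ii) the factor (1−β)² on the left side is removed: with it the identity is false (for β=q, 0<|q|<1, the right side is 1 but the printed left side is (1−q)²). *)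

(* Defs.v *)
From mathcomp Require Import all_boot all_order all_algebra.
From mathcomp Require Import all_classical all_reals all_analysis.
From mathcomp Require Import complex.
From mathcomp Require Import ring.

Set Implicit Arguments.
Unset Strict Implicit.
Unset Printing Implicit Defensive.

Import Order.TTheory GRing.Theory Num.Theory.
Import numFieldNormedType.Exports.

Local Open Scope ring_scope.
Local Open Scope classical_set_scope.

(* The complex numbers over R, packed so that the topology and the limits
   are those of the norm `|z| carried by every numClosedFieldType. *)
Definition Cplx (R : realType) : numClosedFieldType := R[i].

(* (a|q)_n *)
Definition qpoch (A : comNzRingType) (a q : A) (n : nat) : A :=
  \prod_(j < n) (1 - a * q ^+ j).

(* x^n (y/x | q)_n read as a polynomial, so that x = 0 is allowed;
   see [hqpochE]. *)
Definition hqpoch (A : comNzRingType) (x y q : A) (n : nat) : A :=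
  \prod_(j < n) (x - y * q ^+ j).

(* (a|q)_oo; the limit exists whenever |q| < 1. *)
Definition qpoch_inf (R : realType) (a q : Cplx R) : Cplx R :=
  lim (qpoch a q n @[n --> \oo]).

(* The Gauss polynomial, by the q-Pascal rule, so that it makes sense at
   every q, roots of unity included; see [qbinE] for the quotient formula.
   Over {poly A}, [qbin 'X n k] is the polynomial itself. *)
Fixpoint qbin (A : comNzRingType) (q : A) (n k : nat) : A :=
  match n, k with
  | _, 0%N => 1
  | 0%N, _.+1 => 0
  | n'.+1, k'.+1 => qbin q n' k' + q ^+ k'.+1 * qbin q n' k'.+1
  end.

(* The value at x of the rational function N / D put in lowest terms: it is
   N(x) / D(x) as soon as D(x) != 0 ([ratvalE]), and it is also meaningful
   at the removable singularities of N / D. *)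
Definition ratval (F : fieldType) (N D : {poly F}) (x : F) : F :=
  (N %/ gcdp N D).[x] / (D %/ gcdp N D).[x].

Lemma hqpochE (F : fieldType) (x y q : F) (n : nat) :
  x != 0 -> hqpoch x y q n = x ^+ n * qpoch (y / x) q n.
Proof.
move=> x0; rewrite /hqpoch /qpoch -[in x ^+ n](card_ord n) -prodr_const.
rewrite -big_split /=; apply: eq_bigr => j _.
by rewrite mulrBr mulr1 !mulrA [x * y]mulrC mulfK.
Qed.

Lemma qpochS (A : comNzRingType) (q : A) n :
  qpoch q q n.+1 = qpoch q q n * (1 - q ^+ n.+1).
Proof. by rewrite /qpoch big_ord_recr /= exprS. Qed.

Lemma qbin_gt (A : comNzRingType) (q : A) n k : (n < k)%N -> qbin q n k = 0.
Proof.
elim: n k => [|n IH] [|k] //= lt_nk.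
by rewrite !IH ?mulr0 ?addr0 // ltnW.
Qed.

Lemma qbin0 (A : comNzRingType) (q : A) n : qbin q n 0 = 1.
Proof. by case: n. Qed.

Lemma qbin_poch (A : comNzRingType) (q : A) n k : (k <= n)%N ->
  qbin q n k * (qpoch q q k * qpoch q q (n - k)) = qpoch q q n.
Proof.
have p0 : qpoch q q 0 = 1 by rewrite /qpoch big_ord0.
elim: n k => [|n IH] [|k] //= le_kn; rewrite ?p0 ?mulr1 ?mul1r //.
have le_kn' : (k <= n)%N by [].
rewrite subSS mulrDl; case: (ltnP k n) => [lt_kn|le_nk].
  have e : (n - k = (n - k.+1).+1)%N by rewrite subnSK.
  have H1 := IH _ le_kn'; have H2 := IH _ lt_kn.
  have -> : qbin q n k * (qpoch q q k.+1 * qpoch q q (n - k))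
          = qpoch q q n * (1 - q ^+ k.+1) by rewrite -H1 qpochS; ring.
  have -> : q ^+ k.+1 * qbin q n k.+1 * (qpoch q q k.+1 * qpoch q q (n - k))
          = qpoch q q n * (q ^+ k.+1 * (1 - q ^+ (n - k))).
    by rewrite -H2 e (qpochS q (n - k.+1)); ring.
  rewrite qpochS -mulrDr; congr (_ * _).
  have -> : q ^+ n.+1 = q ^+ k.+1 * q ^+ (n - k).
    by rewrite -exprD addSn subnKC.
  by ring.
have -> : k = n by apply/eqP; rewrite eqn_leq le_kn'.
rewrite (qbin_gt q (ltnSn n)) mulr0 mul0r addr0 subnn p0 mulr1 qpochS mulrA.
by have := IH n (leqnn n); rewrite subnn p0 mulr1 => ->.
Qed.

Lemma qbinE (F : fieldType) (q : F) n k : (k <= n)%N ->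
  qpoch q q k * qpoch q q (n - k) != 0 ->
  qbin q n k = qpoch q q n / (qpoch q q k * qpoch q q (n - k)).
Proof. by move=> le_kn nz; rewrite -(qbin_poch q le_kn) mulfK. Qed.

Lemma horner_qbin (F : fieldType) (x : F) n k :
  (qbin 'X n k).[x] = qbin x n k.
Proof.
elim: n k => [|n IH] [|k] /=; rewrite ?hornerC //.
by rewrite hornerD hornerM hornerXn !IH.
Qed.

Lemma ratvalE (F : fieldType) (N D : {poly F}) (x : F) :
  D.[x] != 0 -> ratval N D x = N.[x] / D.[x].
Proof.
move=> Dx; rewrite /ratval; set g := gcdp N D.
have eN : N.[x] = (N %/ g).[x] * g.[x] by rewrite -hornerM divpK ?dvdp_gcdl.
have eD : D.[x] = (D %/ g).[x] * g.[x] by rewrite -hornerM divpK ?dvdp_gcdr.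
move: Dx; rewrite eN eD mulf_eq0 negb_or => /andP[_ gx].
by rewrite -mulf_div divff // mulr1.
Qed.

(* Main.v *)
Require Import Defs.
From mathcomp Require Import all_boot all_order all_algebra.
From mathcomp Require Import all_classical all_reals all_analysis.
From mathcomp Require Import complex ring lra zify.
Import Order.TTheory GRing.Theory Num.Theory.
Import numFieldNormedType.Exports.
Local Open Scope ring_scope.
Local Open Scope classical_set_scope.

Set Implicit Arguments.
Unset Strict Implicit.
Unset Printing Implicit Defensive.

(** Both sums of (i) are terminating very-well-poised 6phi5 series whose
parameters satisfy a = bcd; such series are indefinitely summable, and the
closed form of the partial sum vanishes at the last index.  The closed form
only appears after multiplication by factors such as 1 - q^n that may vanish,
so the identity is proved in the polynomial ring with q an indeterminate, where
these factors can be cancelled, and then evaluated at q.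

In (ii), put t_n(b) = b^n (q/b)_n / (b)_(n+1) and t_(-1) = - t_0.  Then
(1-b) ((1+b^2) t_n(b) - b t_(n-1)(b) - b t_(n+1)(b)) = (1+b) (1-q b^2) t_n(bq).
Summing against weights x_n with x_(n+1) + x_(n-1) = s x_n, x_0 = 1 and
x_(-1) = -1 (so x_n = (-1)^n for s = -2 and x_n = 2n+1 for s = 2) yields
(1-b) (1-sb+b^2) F(b) = (1+b) (1-q b^2) F(bq) for the sum F of the series.
Iterating b -> bq expresses F(b) as an infinite product times F(0), and F(0) is
found by taking b = q, where the series reduces to its first term.  The second
series of (ii) is treated in the same way, with a functional equation coming
from a telescoping sum. *)

(** * Finite identities *)

Section QPochhammer.
Variable A : comNzRingType.
Implicit Types a b q x y : A.

Lemma qpoch0 a q : qpoch a q 0 = 1.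
Proof. by rewrite /qpoch big_ord0. Qed.

Lemma qpochSr a q n : qpoch a q n.+1 = qpoch a q n * (1 - a * q ^+ n).
Proof. by rewrite /qpoch big_ord_recr. Qed.

Lemma qpochD a q m n : qpoch a q (m + n) = qpoch a q m * qpoch (a * q ^+ m) q n.
Proof.
elim: n => [|n IHn]; first by rewrite addn0 qpoch0 mulr1.
by rewrite addnS !qpochSr IHn exprD !mulrA.
Qed.

Lemma qpochSl a q n : qpoch a q n.+1 = (1 - a) * qpoch (a * q) q n.
Proof. by rewrite -add1n qpochD qpochSr qpoch0 mul1r expr0 mulr1 expr1. Qed.

Lemma hqpoch0 x y q : hqpoch x y q 0 = 1.
Proof. by rewrite /hqpoch big_ord0. Qed.

Lemma hqpochSr x y q n : hqpoch x y q n.+1 = hqpoch x y q n * (x - y * q ^+ n).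
Proof. by rewrite /hqpoch big_ord_recr. Qed.

Lemma qbin_rec q N k : (k <= N)%N ->
  (1 - q ^+ k.+1) * qbin q N k.+1 = (1 - q ^+ (N - k)) * qbin q N k.
Proof.
elim: N k => [|N IHN] [|k] // le_kN; first by rewrite subrr mul0r mulr0.
  rewrite /= qbin0 subn0 mulr1 expr1 mulrDr mulr1.
  have -> : (1 - q) * (q * qbin q N 1) = q * ((1 - q ^+ 1) * qbin q N 1).
    by rewrite expr1; ring.
  by rewrite IHN // qbin0 subn0 exprS; ring.
have -> : qbin q N.+1 k.+2 = qbin q N k.+1 + q ^+ k.+2 * qbin q N k.+1.+1 by [].
have -> : qbin q N.+1 k.+1 = qbin q N k + q ^+ k.+1 * qbin q N k.+1 by [].
rewrite ltnS in le_kN; rewrite subSS.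
have e : q ^+ k.+1 * q ^+ (N - k) = q ^+ N.+1 by rewrite -exprD addSn subnKC.
have H0 := IHN k le_kN.
move: le_kN; rewrite leq_eqVlt => /orP[/eqP kN|lt_kN].
  rewrite -kN subnn !(qbin_gt _ (leqnn _.+1)) (qbin_gt _ (leqW (leqnn _.+1))).
  by rewrite expr0; ring.
have H1 := IHN k.+1 lt_kN.
have e1 : q ^+ k.+2 * q ^+ (N - k.+1) = q ^+ N.+1.
  by rewrite -exprD addSnnS subnSK // addSn subnKC // ltnW.
transitivity ((1 - q ^+ N.+1) * qbin q N k.+1).
  rewrite mulrDr.
  have -> : (1 - q ^+ k.+2) * (q ^+ k.+2 * qbin q N k.+2) =
            q ^+ k.+2 * ((1 - q ^+ k.+2) * qbin q N k.+2) by ring.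
  by rewrite H1 -e1; ring.
by rewrite mulrDr -H0 -e; ring.
Qed.

End QPochhammer.

Section QPochhammerMorphism.
Variables (A B : comNzRingType) (f : {rmorphism A -> B}).

Lemma rmorph_qpoch a q n : f (qpoch a q n) = qpoch (f a) (f q) n.
Proof.
rewrite /qpoch rmorph_prod; apply: eq_bigr => j _.
by rewrite rmorphB rmorphM rmorphXn rmorph1.
Qed.

Lemma rmorph_hqpoch x y q n : f (hqpoch x y q n) = hqpoch (f x) (f y) (f q) n.
Proof.
rewrite /hqpoch rmorph_prod; apply: eq_bigr => j _.
by rewrite rmorphB rmorphM rmorphXn.
Qed.

Lemma rmorph_qbin q n k : f (qbin q n k) = qbin (f q) n k.
Proof.
elim: n k => [|n IHn] [|k] /=; rewrite ?rmorph1 ?rmorph0 //.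
by rewrite rmorphD rmorphM rmorphXn !IHn.
Qed.

End QPochhammerMorphism.

Lemma odd_bin_partial_sum (A : comNzRingType) (q b : A) n m : (0 < n)%N -> (m <= n)%N ->
  (1 - q ^+ n) * (b - q) * (1 - b * q ^+ n) *
  (\sum_(k < m.+1)
     qbin q (2 * n + 1) (n - k) * (hqpoch b q q k * hqpoch q b q (n - k))
     * (1 - q ^+ (2 * k + 1)) * qpoch (b * q ^+ k.+1) q (n - 1)) =
  qbin q (2 * n + 1) (n - m) * (1 - q ^+ (n - m)) * (1 - q ^+ m.+1)
  * (hqpoch b q q m.+1 * hqpoch q b q (n - m))
  * (1 - b * q ^+ (n + m)) * qpoch (b * q ^+ m.+1) q (n - 1).
Proof.
move=> n0; elim: m => [|m IHm] le_mn.
  by rewrite big_ord1 subn0 hqpochSr hqpoch0 addn0 expr1; ring.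
rewrite big_ord_recr mulrDr IHm /=; last exact: ltnW.
have [d dE] : exists d, (n = m.+1 + d)%N by exists (n - m.+1)%N; rewrite subnKC.
have e1 : (n - m = d.+1)%N by rewrite dE addSnnS addKn.
have e2 : (n - m.+1 = d)%N by rewrite dE addKn.
have Q : qpoch (b * q ^+ m.+1) q (n - 1) * (1 - b * q ^+ (n + m)) =
   (1 - b * q ^+ m.+1) * qpoch (b * q ^+ m.+2) q (n - 1).
  case: n n0 {IHm le_mn dE e1 e2} => // n _; rewrite subSS subn0.
  rewrite [q ^+ m.+2]exprSr [b * (_ * q)]mulrA -qpochSl qpochSr.
  by rewrite addSn [q ^+ (_ + m).+1]exprS exprD exprS; congr (_ * (_ - _)); ring.
have := @qbin_rec A q (2 * n + 1) d.
rewrite e1 e2 (hqpochSr _ _ _ m.+1) (hqpochSr _ _ _ d) => B.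
have Nd : (2 * n + 1 - d = (m + m + d).+3)%N by rewrite dE; lia.
rewrite {}Nd in B; have {}B := B ltac:(lia).
transitivity (
  ((1 - q ^+ d.+1) * qbin q (2 * n + 1) d.+1) * (1 - q ^+ m.+1)
  * (hqpoch b q q m.+1 * (hqpoch q b q d * (q - b * q ^+ d)))
  * (qpoch (b * q ^+ m.+1) q (n - 1) * (1 - b * q ^+ (n + m))) +
  (1 - q ^+ n) * (b - q) * (1 - b * q ^+ n) *
  (qbin q (2 * n + 1) d * (hqpoch b q q m.+1 * hqpoch q b q d) *
   (1 - q ^+ (2 * m.+1 + 1)) * qpoch (b * q ^+ m.+2) q (n - 1))).
  by congr (_ + _); ring.
rewrite {}B {}Q.
have -> : q ^+ (2 * m.+1 + 1) = q ^+ 3 * q ^+ m * q ^+ m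
  by rewrite -!exprD; congr (_ ^+ _); lia.
have -> : q ^+ (n + m.+1) = q ^+ 2 * q ^+ m * q ^+ m * q ^+ d
  by rewrite -!exprD; congr (_ ^+ _); lia.
have -> : q ^+ (m + m + d).+3 = q ^+ 3 * q ^+ m * q ^+ m * q ^+ d
  by rewrite -!exprD; congr (_ ^+ _); lia.
have -> : q ^+ n = q * q ^+ m * q ^+ d by rewrite -exprS -!exprD dE.
move: (hqpoch b q q m.+1) => H; rewrite !exprS.
by ring.
Qed.

Lemma odd_bin_sum_eq0 (F : fieldType) (q b : F) n : (0 < n)%N ->
  \sum_(k < n.+1)
     qbin q (2 * n + 1) (n - k) * (hqpoch b q q k * hqpoch q b q (n - k))
     * (1 - q ^+ (2 * k + 1)) * qpoch (b * q ^+ k.+1) q (n - 1) = 0.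
Proof.
move=> n0; have := odd_bin_partial_sum 'X b%:P n0 (leqnn n).
rewrite subnn expr0 subrr mulr0 !mul0r => /eqP.
have nz (p : {poly F}) x : p.[x] != 0 -> p != 0.
  by apply: contra_neq => ->; rewrite horner0.
rewrite !mulf_eq0 (negPf (nz (1 - 'X^n) 0 _)); last first.
  by rewrite !hornerE expr0n gtn_eqF // subr0 oner_neq0.
rewrite (negPf (nz (b%:P - 'X) (b - 1) _)); last by rewrite !hornerE subKr oner_neq0.
rewrite (negPf (nz (1 - b%:P * 'X^n) 0 _)) /=; last first.
  by rewrite !hornerE expr0n gtn_eqF // mulr0 subr0 oner_neq0.
move=> /eqP/(congr1 (horner_eval q)); rewrite rmorph0 rmorph_sum => {2}<-.
apply: eq_bigr => k _.
rewrite !rmorphM rmorphB !rmorphXn rmorph1 rmorph_qpoch rmorph_qbin !rmorph_hqpoch.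
by rewrite rmorphM rmorphXn /= /horner_eval hornerX hornerC.
Qed.

(* The polynomial (1 - q) [n, k] [n+k, k] / (1 - q^(k+1)), see [qcat_prod]; the
   second factor is the q-Catalan number. *)
Definition qcat (A : comNzRingType) (q : A) n k :=
  qbin q (n + k) (2 * k) * (qbin q (2 * k) k - q * qbin q (2 * k) k.+1).

Lemma qcat_poch (A : comNzRingType) (q : A) n k : (k <= n)%N ->
  qcat q n k * (qpoch q q k * qpoch q q k.+1 * qpoch q q (n - k)) =
  (1 - q) * qpoch q q (n + k).
Proof.
move=> le_kn.
have := @qbin_rec A q (2 * k) k; have := @qbin_poch A q (2 * k) k.
have := @qbin_poch A q (n + k) (2 * k).
have -> : (n + k - 2 * k = n - k)%N by lia.
have -> : (2 * k - k = k)%N by lia.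
move=> /(_ ltac:(lia)) <- /(_ ltac:(lia)) <- /(_ ltac:(lia)) e.
rewrite /qcat qpochS.
transitivity (qbin q (n + k) (2 * k) *
  ((1 - q ^+ k.+1) * qbin q (2 * k) k -
   q * ((1 - q ^+ k.+1) * qbin q (2 * k) k.+1)) *
  (qpoch q q k * qpoch q q k * qpoch q q (n - k))); first by ring.
by rewrite e exprS; ring.
Qed.

Section QCatalan.
Variables (A : idomainType) (q : A).
Hypothesis q_gen : forall n, qpoch q q n != 0.

Lemma qcat_prod n k : (k <= n)%N ->
  (1 - q ^+ k.+1) * qcat q n k = (1 - q) * (qbin q n k * qbin q (n + k) k).
Proof.
move=> le_kn.
apply: (@mulIf _ (qpoch q q k * qpoch q q k * qpoch q q (n - k))).
  by rewrite !mulf_neq0.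
transitivity (qcat q n k * (qpoch q q k * qpoch q q k.+1 * qpoch q q (n - k))).
  by rewrite qpochS; ring.
rewrite qcat_poch // -(@qbin_poch _ q (n + k) k) ?leq_addl // addnK.
by rewrite -(qbin_poch _ le_kn); ring.
Qed.

Lemma qcat_rec n k : (k < n)%N ->
  qcat q n k * ((1 - q ^+ (n - k)) * (1 - q ^+ (n + k).+1)) =
  qcat q n k.+1 * ((1 - q ^+ k.+1) * (1 - q ^+ k.+2)).
Proof.
move=> lt_kn.
apply: (@mulIf _ (qpoch q q k * qpoch q q k.+1 * qpoch q q (n - k.+1))).
  by rewrite !mulf_neq0.
transitivity ((1 - q ^+ (n + k).+1) *
  (qcat q n k * (qpoch q q k * qpoch q q k.+1 * qpoch q q (n - k)))).
  have -> : (n - k = (n - k.+1).+1)%N by rewrite subnSK.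
  by rewrite [qpoch q q (_ - _).+1]qpochS; ring.
transitivity (qcat q n k.+1 *
  (qpoch q q k.+1 * qpoch q q k.+2 * qpoch q q (n - k.+1))); last first.
  by rewrite [qpoch q q k.+2]qpochS [qpoch q q k.+1]qpochS; ring.
by rewrite !qcat_poch ?(ltnW lt_kn) // addnS [qpoch q q (n + k).+1]qpochS; ring.
Qed.

Lemma qcat_partial_sum (b : A) n m : (0 < n)%N -> (m <= n)%N ->
  (1 - q ^+ n) * (1 - q ^+ n.+1) * (q - b) *
  (\sum_(k < m.+1)
     qcat q n k * (hqpoch q b q k * hqpoch b q q (n - k))
     * ((1 - b * q ^+ (2 * k))
        * (qpoch b q k * qpoch (b * q ^+ (n + k).+1) q (n - k)))) =
  qcat q n m * ((1 - q ^+ (n - m)) * (1 - q ^+ (n + m).+1))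
  * (hqpoch q b q m.+1 * hqpoch b q q (n - m))
  * (qpoch b q m.+1 * qpoch (b * q ^+ (n + m).+1) q (n - m)).
Proof.
move=> n0; elim: m => [|m IHm] le_mn.
  by rewrite big_ord1 subn0 hqpochSr qpochSr hqpoch0 qpoch0 addn0 muln0 expr0; ring.
rewrite big_ord_recr mulrDr IHm /=; last exact: ltnW.
rewrite qcat_rec //.
have [d dE] : exists d, (n = m.+1 + d)%N by exists (n - m.+1)%N; rewrite subnKC.
have e1 : (n - m = d.+1)%N by rewrite dE addSnnS addKn.
have e2 : (n - m.+1 = d)%N by rewrite dE addKn.
have Q : qpoch (b * q ^+ (n + m).+1) q d.+1 =
   (1 - b * q ^+ (n + m).+1) * qpoch (b * q ^+ (n + m.+1).+1) q d.
  by rewrite qpochSl addnS [in q ^+ (n + m).+2]exprSr mulrA.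
rewrite e1 e2 {}Q (hqpochSr _ _ _ m.+1) (hqpochSr _ _ _ d) (qpochSr _ _ m.+1).
have -> : q ^+ (2 * m.+1) = q ^+ 2 * q ^+ m * q ^+ m
  by rewrite -!exprD; congr (_ ^+ _); lia.
have -> : q ^+ (n + m).+1 = q ^+ 2 * q ^+ m * q ^+ m * q ^+ d
  by rewrite -!exprD; congr (_ ^+ _); lia.
have -> : q ^+ (n + m.+1).+1 = q ^+ 3 * q ^+ m * q ^+ m * q ^+ d
  by rewrite -!exprD; congr (_ ^+ _); lia.
have -> : q ^+ n.+1 = q ^+ 2 * q ^+ m * q ^+ d
  by rewrite -!exprD; congr (_ ^+ _); lia.
have -> : q ^+ n = q * q ^+ m * q ^+ d by rewrite -exprS -!exprD dE.
move: (hqpoch q b q m.+1) (qpoch b q m.+1) (qpoch (b * _) _ _) => H P P'.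
by rewrite !exprS; ring.
Qed.

End QCatalan.

Section RationalFunctions.
Variable F : fieldType.
Implicit Types q b : F.

Lemma qpochX_neq0 n : qpoch 'X 'X n != 0 :> {poly F}.
Proof.
apply/prodf_neq0 => j _; apply/eqP => /(congr1 (horner^~ 0)); rewrite -exprS.
by rewrite !hornerE expr0n subr0 => /eqP; rewrite oner_eq0.
Qed.

Lemma ratval_cross (N D N' D' : {poly F}) (x : F) :
  D != 0 -> N * D' = N' * D -> D'.[x] != 0 -> ratval N D x = N'.[x] / D'.[x].
Proof.
move=> D0 e D'x; rewrite /ratval; set g := gcdp N D.
have g0 : g != 0 by rewrite gcdp_eq0 (negPf D0) andbF.
have eN : N = N %/ g * g by rewrite divpK ?dvdp_gcdl.
have eD : D = D %/ g * g by rewrite divpK ?dvdp_gcdr.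
have {}e : N %/ g * D' = N' * (D %/ g).
  by apply: (mulIf g0); rewrite mulrAC -eN e -mulrA -eD.
have /(congr1 (horner^~ x)) := e; rewrite !hornerM => ex.
have Dx : (D %/ g).[x] != 0.
  apply/eqP => Dx; move: ex; rewrite Dx mulr0 => /eqP.
  rewrite mulf_eq0 (negPf D'x) orbF => Nx.
  have /coprimep_root/(_ Nx) : coprimep (N %/ g) (D %/ g).
    by rewrite coprimep_div_gcd // D0 orbT.
  by rewrite Dx eqxx.
by apply/eqP; rewrite eqr_div // ex.
Qed.

Lemma ratval_qcat q n k : q != 1 -> (k <= n)%N ->
  ratval (qbin 'X n k * qbin 'X (n + k) k) (1 - 'X^(k.+1)) q =
  qcat q n k / (1 - q).
Proof.
move=> q1 le_kn.
have D0 : 1 - 'X^(k.+1) != 0 :> {poly F}.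
  apply/eqP => /(congr1 (horner^~ 0)).
  by rewrite !hornerE expr0n subr0 => /eqP; rewrite oner_eq0.
have e := qcat_prod qpochX_neq0 le_kn.
have Dq : (1 - 'X : {poly F}).[q] != 0 by rewrite !hornerE subr_eq0 eq_sym.
rewrite (ratval_cross D0 _ Dq (N' := qcat 'X n k)); last by rewrite mulrC -e mulrC.
by rewrite /qcat !hornerE !horner_qbin.
Qed.

Lemma qcat_sum_eq0 q b n : (0 < n)%N -> q != 1 -> (forall j, b * q ^+ j != 1) ->
  \sum_(k < n.+1)
     ratval (qbin 'X n k * qbin 'X (n + k) k) (1 - 'X^(k.+1)) q
     * (hqpoch q b q k * hqpoch b q q (n - k))
     * ((1 - b * q ^+ (2 * k)) / qpoch (b * q ^+ k) q n.+1) = 0.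
Proof.
move=> n0 q1 bq.
have nz (p : {poly F}) x : p.[x] != 0 -> p != 0.
  by apply: contra_neq => ->; rewrite horner0.
have P0 m k : qpoch (b * q ^+ m) q k != 0.
  by apply/prodf_neq0 => j _; rewrite -mulrA -exprD subr_eq0 eq_sym.
have := qcat_partial_sum qpochX_neq0 b%:P n0 (leqnn n).
rewrite subnn expr0 subrr !(mul0r, mulr0) => /eqP.
rewrite !mulf_eq0 (negPf (nz (1 - 'X^n) 0 _)); last first.
  by rewrite !hornerE expr0n gtn_eqF // subr0 oner_neq0.
rewrite (negPf (nz (1 - 'X^(n.+1)) 0 _)); last first.
  by rewrite !hornerE expr0n subr0 oner_neq0.
rewrite (negPf (nz ('X - b%:P) (b + 1) _)) /=; last first.
  by rewrite !hornerE addrAC subrr add0r oner_neq0.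
move=> /eqP/(congr1 (horner_eval q)); rewrite rmorph0 rmorph_sum.
move=> /(congr1 (fun x => x / ((1 - q) * qpoch b q (n + n.+1)))).
rewrite mul0r mulr_suml => e; rewrite -[RHS]e; apply: eq_bigr => -[k /= lt_kn] _.
rewrite ratval_qcat // !rmorphM rmorphB !rmorphM.
rewrite (rmorph_qpoch _ b%:P) (rmorph_qpoch _ (b%:P * _)) !rmorph_hqpoch.
rewrite rmorphB !rmorphM !rmorph_qbin !rmorphXn rmorph1 /= /horner_eval hornerX hornerC.
rewrite -/(qcat q n k).
have -> : (n + n.+1 = k + (n.+1 + (n - k)))%N by lia.
rewrite 2!qpochD -[b * _ * q ^+ n.+1]mulrA -exprD addnS [(k + n)%N]addnC.
have := P0 0%N k; rewrite expr0 mulr1 => P0k.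
have q1' : 1 - q != 0 by rewrite subr_eq0 eq_sym.
by field; rewrite q1' P0k !P0.
Qed.

End RationalFunctions.

(** * Complex sequences and series *)

Lemma cvg_sum_seq (K : numFieldType) (I : Type) (s : seq I) (f : I -> nat -> K)
    (l : I -> K) : (forall i, f i n @[n --> \oo] --> l i) ->
  \sum_(i <- s) f i n @[n --> \oo] --> \sum_(i <- s) l i.
Proof.
move=> fl; elim: s => [|i s IHs].
  by rewrite big_nil; under eq_cvg do rewrite big_nil; exact: cvg_cst.
by rewrite big_cons; under eq_cvg do rewrite big_cons; exact: cvgD.
Qed.

Section RealNorm.
Variable R : realType.
Local Notation C := (Cplx R).
Implicit Types (z : C) (u : nat -> C).

(* `|z| : C is a real number of C; nrm z is the same number in R. *)
Definition nrm z : R := complex.Re (`|z| : R[i]).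

Lemma nrmE z : `|z| = (nrm z)%:C%C :> C.
Proof. by rewrite -[LHS](@RRe_real R) // normr_real. Qed.

Lemma nrm_ge0 z : 0 <= nrm z.
Proof. by rewrite -lecR -[X in _ <= X]nrmE; exact: normr_ge0. Qed.

Lemma nrmM z1 z2 : nrm (z1 * z2) = nrm z1 * nrm z2.
Proof. by apply: complexI; rewrite rmorphM -!nrmE; exact: normrM. Qed.

Lemma nrmV z : nrm z^-1 = (nrm z)^-1.
Proof. by apply: complexI; rewrite fmorphV -!nrmE; exact: normfV. Qed.

Lemma nrmN z : nrm (- z) = nrm z.
Proof. by rewrite /nrm normrN. Qed.

Lemma nrm1 : nrm 1 = 1.
Proof. by apply: complexI; rewrite rmorph1 -nrmE; exact: normr1. Qed.

Lemma nrmX z n : nrm (z ^+ n) = nrm z ^+ n.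
Proof. by apply: complexI; rewrite rmorphXn -!nrmE; exact: normrX. Qed.

Lemma nrm_natr n : nrm n%:R = n%:R.
Proof. by apply: complexI; rewrite rmorph_nat -nrmE; exact: normr_nat. Qed.

Lemma nrmB_sym z1 z2 : nrm (z1 - z2) = nrm (z2 - z1).
Proof. by rewrite -nrmN opprB. Qed.

Lemma ler_nrmD z1 z2 : nrm (z1 + z2) <= nrm z1 + nrm z2.
Proof. by rewrite -lecR rmorphD -!nrmE; exact: ler_normD. Qed.

Lemma ler_nrmB z1 z2 : nrm (z1 - z2) <= nrm z1 + nrm z2.
Proof. by rewrite -(nrmN z2) ler_nrmD. Qed.

Lemma nrm_lt1 z : (`|z| < 1) = (nrm z < 1).
Proof. by rewrite -ltcR -nrmE. Qed.

Lemma nrm_eq0 z : (nrm z == 0) = (z == 0).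
Proof.
rewrite -[RHS]normr_eq0 nrmE.
by apply/eqP/eqP => [->//|/(congr1 (@complex.Re R))].
Qed.

Lemma nrm0 : nrm 0 = 0.
Proof. by apply/eqP; rewrite nrm_eq0. Qed.

Lemma cvg_nrm (T : Type) (F : set_system T) (FF : Filter F) (u : T -> C) (l : C) :
  (u @ F --> l) <-> ((fun n => nrm (u n - l)) @ F --> (0 : R)).
Proof.
split=> [/cvgrPdist_lt cu|cu].
  apply/cvgr0Pnorm_lt => e e0.
  have e0C : 0 < (e%:C%C : C) by rewrite -[0]/((0 : R)%:C%C) ltcR.
  apply: filterS (cu _ e0C) => n.
  by rewrite nrmE ltcR ger0_norm ?nrm_ge0 // nrmB_sym.
apply/cvgrPdist_lt => e e0.
have eE : e = (complex.Re (e : R[i]))%:C%C.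
  by rewrite (@RRe_real R) //; apply: gtr0_real.
have e0R : 0 < complex.Re (e : R[i]) by rewrite -ltcR -eE.
move: cu => /cvgr0Pnorm_lt/(_ _ e0R); apply: filterS => n.
by rewrite nrmE nrmB_sym eE ltcR ger0_norm ?nrm_ge0.
Qed.

Lemma nrm_sqrt z :
  nrm z = Num.sqrt (complex.Re (z : R[i]) ^+ 2 + complex.Im (z : R[i]) ^+ 2).
Proof. by rewrite /nrm normc_def. Qed.

Lemma ler_Re_nrm z : `|complex.Re (z : R[i])| <= nrm z.
Proof. by rewrite nrm_sqrt -sqrtr_sqr ler_wsqrtr // lerDl sqr_ge0. Qed.

Lemma ler_Im_nrm z : `|complex.Im (z : R[i])| <= nrm z.
Proof. by rewrite nrm_sqrt -sqrtr_sqr ler_wsqrtr // lerDr sqr_ge0. Qed.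

Lemma nrm_ler_ReIm z :
  nrm z <= `|complex.Re (z : R[i])| + `|complex.Im (z : R[i])|.
Proof.
rewrite nrm_sqrt -[leRHS]ger0_norm ?addr_ge0 // -sqrtr_sqr ler_wsqrtr //.
by rewrite sqrrD !real_normK ?num_real // -addrA lerD2l lerDr mulrn_wge0 ?mulr_ge0.
Qed.

Lemma cvg_ReIm (T : Type) (F : set_system T) (FF : Filter F) (u : T -> C) (a b : R) :
  (fun n => complex.Re (u n : R[i])) @ F --> a ->
  (fun n => complex.Im (u n : R[i])) @ F --> b ->
  u @ F --> ((a +i* b)%C : C).
Proof.
move=> ua ub; apply/cvg_nrm.
have h : (fun n => `|complex.Re (u n : R[i]) - a| + `|complex.Im (u n : R[i]) - b|)
    @ F --> (0 : R).
  rewrite -[X in _ --> X]addr0; apply: cvgD; rewrite -[X in _ --> X](normr0 R).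
    by apply: cvg_norm; rewrite -(subrr a); apply: cvgB => //; exact: cvg_cst.
  by apply: cvg_norm; rewrite -(subrr b); apply: cvgB => //; exact: cvg_cst.
apply: (squeeze_cvgr _ (cvg_cst (0 : R)) h).
apply: nearW => n; rewrite nrm_ge0 /=.
have -> : complex.Re (u n : R[i]) - a = complex.Re ((u n - (a +i* b)%C) : R[i]).
  by case: (u n).
have -> : complex.Im (u n : R[i]) - b = complex.Im ((u n - (a +i* b)%C) : R[i]).
  by case: (u n).
exact: nrm_ler_ReIm.
Qed.

Lemma cvg_series_nrm u (w : nat -> R) :
  (forall n, nrm (u n) <= w n) -> cvgn (series w) -> cvgn (series u).
Proof.
move=> uw cw.
have part (f : C -> R) : (forall z, `|f z| <= nrm z) ->
    cvgn (series (fun n => f (u n))).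
  move=> fn; apply: normed_cvg; apply: series_le_cvg cw => n //=.
  - by apply: le_trans (uw n); exact: nrm_ge0.
  - by apply: le_trans (uw n); exact: fn.
have /cvg_ex[a ca] := part _ ler_Re_nrm.
have /cvg_ex[b cb] := part _ ler_Im_nrm.
have sum_Re n : complex.Re (series u n : R[i]) =
    series (fun k => complex.Re (u k : R[i])) n.
  rewrite /series /=; elim: n => [|n IHn]; first by rewrite !big_geq.
  by rewrite !big_nat_recr //= -IHn; case: (\sum_(0 <= k < n) _); case: (u n).
have sum_Im n : complex.Im (series u n : R[i]) =
    series (fun k => complex.Im (u k : R[i])) n.
  rewrite /series /=; elim: n => [|n IHn]; first by rewrite !big_geq.
  by rewrite !big_nat_recr //= -IHn; case: (\sum_(0 <= k < n) _); case: (u n).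
apply/cvg_ex; exists (a +i* b)%C; apply: cvg_ReIm.
  by rewrite (funext sum_Re).
by rewrite (funext sum_Im).
Qed.

Lemma cvg_nrm_lt u (l : C) (e : R) : u @ \oo --> l -> 0 < e ->
  \forall n \near \oo, nrm (u n - l) < e.
Proof.
move=> /cvg_nrm/cvgr0Pnorm_lt cu /cu; apply: filterS => n.
by rewrite ger0_norm ?nrm_ge0.
Qed.

Lemma cvg_nrm_val u (l : C) : u @ \oo --> l -> (fun n => nrm (u n)) @ \oo --> nrm l.
Proof.
move=> /cvg_nrm h.
apply/cvgrPdist_le => e e0; move/cvgr0Pnorm_le: h => /(_ _ e0).
apply: filterS => m; rewrite (ger0_norm (nrm_ge0 _)); apply: le_trans.
rewrite ler_norml; have := ler_nrmD l (u m - l); have := ler_nrmB (u m) (u m - l).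
rewrite subKr [l + _]addrC subrK; lra.
Qed.

Section GeometricDomination.
Variables (r K : R).
Hypotheses (r0 : 0 < r) (r1 : r < 1).

Lemma dominated_cvg u : (forall n, nrm (u n) <= K * r ^+ n) -> cvgn (series u).
Proof.
move=> uK; apply: cvg_series_nrm uK _.
by apply: is_cvg_geometric_series; rewrite ger0_norm // ltW.
Qed.

Lemma dominated_tail u M : (forall n, nrm (u n) <= K * r ^+ n) ->
  nrm (limn (series u) - series u M) <= K * r ^+ M / (1 - r).
Proof.
move=> uK; have K0 : 0 <= K by have := uK 0; rewrite mulr1; exact/le_trans/nrm_ge0.
have r1' : 0 < 1 - r by rewrite subr_gt0.
have part j : nrm (series u (M + j)%N - series u M) <=
    K * r ^+ M * (1 - r ^+ j) / (1 - r).
  elim: j => [|j IHj].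
    by rewrite addn0 !subrr mulr0 mul0r nrm0.
  rewrite addnS seriesSr addrAC (le_trans (ler_nrmD _ _)) //.
  rewrite (le_trans (lerD IHj (uK _))) // le_eqVlt; apply/orP; left; apply/eqP.
  by rewrite exprS exprD; field; rewrite gt_eqF.
apply/ler_addgt0Pr => e e0.
have [n _ /(_ _ (leq_addl M n)) ne] := cvg_nrm_lt (dominated_cvg uK) e0.
have -> : limn (series u) - series u M =
  (series u (M + n)%N - series u M) - (series u (M + n)%N - limn (series u)) by ring.
rewrite (le_trans (ler_nrmB _ _)) // lerD ?(ltW ne) // (le_trans (part n)) //.
rewrite ler_pM2r ?invr_gt0 // ler_piMr //; first by rewrite mulr_ge0 // exprn_ge0 // ltW.
by rewrite gerBl exprn_ge0 // ltW.
Qed.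

Lemma tannery (u : nat -> nat -> C) (v : nat -> C) :
  (forall m n, nrm (u m n) <= K * r ^+ n) ->
  (forall n, (u m n) @[m --> \oo] --> v n) ->
  limn (series (u m)) @[m --> \oo] --> limn (series v).
Proof.
move=> uK uv.
have K0 : 0 <= K by have := uK 0 0; rewrite mulr1; exact/le_trans/nrm_ge0.
have r1' : 0 < 1 - r by rewrite subr_gt0.
have vK n : nrm (v n) <= K * r ^+ n.
  apply/ler_addgt0Pr => e e0.
  have [m _ /(_ _ (leqnn m)) me] := cvg_nrm_lt (uv n) e0.
  have -> : v n = u m n - (u m n - v n) by ring.
  by rewrite (le_trans (ler_nrmB _ _)) // lerD ?(ltW me).
have part M : series (u m) M @[m --> \oo] --> series v M.
  by rewrite /series /=; apply: cvg_sum_seq => n; exact: uv.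
apply/cvg_nrm/cvgr0Pnorm_lt => e e0.
have : geometric (K / (1 - r)) r @ \oo --> (0 : R).
  by apply: cvg_geometric; rewrite ger0_norm // ltW.
have e3 : 0 < e / 3 by rewrite divr_gt0.
move=> /cvgr0Pnorm_lt/(_ _ e3)[M _ /(_ M (leqnn M))] /= geoM.
have {}geoM : K * r ^+ M / (1 - r) < e / 3.
  by apply: le_lt_trans geoM; rewrite mulrAC ler_norm.
have := cvg_nrm_lt (part M) e3; apply: filterS => m me.
rewrite ger0_norm ?nrm_ge0 //.
have -> : limn (series (u m)) - limn (series v) =
  (limn (series (u m)) - series (u m) M) + (series (u m) M - series v M) -
  (limn (series v) - series v M) by ring.
have := dominated_tail M (uK m); have := dominated_tail M vK.
have := ler_nrmD (limn (series (u m)) - series (u m) M) (series (u m) M - series v M).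
have := ler_nrmB ((limn (series (u m)) - series (u m) M) + (series (u m) M - series v M))
  (limn (series v) - series v M).
move: me geoM; lra.
Qed.

End GeometricDomination.

Section RatioTest.
Variables (r : R) (N : nat).
Hypotheses (r0 : 0 < r) (r1 : r < 1).

Definition ratio_bounded u := forall n, (N <= n)%N -> nrm (u n.+1) <= r * nrm (u n).

Lemma ratio_dominated u n : ratio_bounded u ->
  nrm (u n) <= (\sum_(k < N.+1) nrm (u k) / r ^+ k) * r ^+ n.
Proof.
move=> ru; have rn k : 0 < r ^+ k by rewrite exprn_gt0.
have [nN|Nn] := ltnP n N.+1.
  rewrite -ler_pdivrMr // (bigD1 (Ordinal nN)) //= lerDl sumr_ge0 // => k _.
  by rewrite divr_ge0 ?nrm_ge0 // ltW.
rewrite -(subnKC (ltnW Nn)); elim: (n - N)%N => [|k IHk].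
  rewrite addn0 -ler_pdivrMr // (bigD1 ord_max) //= lerDl sumr_ge0 // => k _.
  by rewrite divr_ge0 ?nrm_ge0 // ltW.
rewrite addnS (le_trans (ru _ (leq_addr _ _))) // exprS mulrCA.
by rewrite ler_pM2l.
Qed.

Lemma ratio_cvg u : ratio_bounded u -> cvgn (series u).
Proof. by move=> ru; apply: (dominated_cvg r0 r1) (fun n => ratio_dominated n ru). Qed.

Lemma ratio_tannery (u : nat -> nat -> C) (v : nat -> C) :
  (forall m, ratio_bounded (u m)) ->
  (forall n, (u m n) @[m --> \oo] --> v n) ->
  limn (series (u m)) @[m --> \oo] --> limn (series v).
Proof.
move=> ru uv.
have cK : cvgn (fun m => \sum_(k < N.+1) nrm (u m k) / r ^+ k).
  apply/cvg_ex; exists (\sum_(k < N.+1) nrm (v k) / r ^+ k).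
  by apply: cvg_sum_seq => k; apply: cvgMr_tmp; exact: cvg_nrm_val.
have [K KP] := cvg_has_ub cK.
apply: (tannery r0 r1 (K := K)) => // m n.
apply: le_trans (ratio_dominated n (ru m)) _.
apply: ler_wpM2r; first by rewrite exprn_ge0 // ltW.
by apply: (le_trans (ler_norm _)); apply: KP; exists m.
Qed.

End RatioTest.
End RealNorm.

(** * Infinite products and series *)

Section InfiniteProducts.
Variable R : realType.
Local Notation C := (Cplx R).
Implicit Types a b q z : C.

Lemma cvgC_unique (u : nat -> C) (l l' : C) :
  u @ \oo --> l -> u @ \oo --> l' -> l = l'.
Proof. by move=> ul ul'; rewrite -(cvg_lim _ ul) // -(cvg_lim _ ul'). Qed.

Lemma cvg_expn (u : nat -> C) (l : C) k :
  u @ \oo --> l -> (u n) ^+ k @[n --> \oo] --> l ^+ k.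
Proof.
move=> ul; elim: k => [|k IHk].
  by under eq_cvg do rewrite expr0; rewrite expr0; exact: cvg_cst.
by under eq_cvg do rewrite exprS; rewrite exprS; apply: cvgM; [exact: ul|exact: IHk].
Qed.

Lemma cvg_eventually_le (f : nat -> R) (l r : R) : f @ \oo --> l -> l < r ->
  exists2 N, (0 < N)%N & forall n, (N <= n)%N -> f n <= r.
Proof.
move=> fl lr; have [N _ fN] := cvgr_le _ fl _ lr.
by exists N.+1 => // n /ltnW; exact: fN.
Qed.

Lemma cvg_exprC q : nrm q < 1 -> q ^+ n @[n --> \oo] --> 0.
Proof.
move=> q1; apply/cvg_nrm; under eq_cvg do rewrite subr0 nrmX.
by apply: cvg_expr; rewrite ger0_norm ?nrm_ge0.
Qed.

Lemma nrm_midpoint q : nrm q < 1 ->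
  [/\ 0 < (1 + nrm q) / 2, (1 + nrm q) / 2 < 1 & nrm q < (1 + nrm q) / 2].
Proof. by move=> q1; have := nrm_ge0 q; split; lra. Qed.

Lemma nrm_expr_le q n : nrm q < 1 -> 0 <= nrm q ^+ n <= 1.
Proof. by move=> q1; rewrite exprn_ge0 ?nrm_ge0 // exprn_ile1 ?nrm_ge0 // ltW. Qed.

Lemma nrm_sub1_ge a x : nrm a <= x -> 1 - x <= nrm (1 - a).
Proof.
move=> ax; have := ler_nrmB 1 (1 - a).
have := ler_nrmD (1 - a) a; rewrite subrK subKr nrm1; lra.
Qed.

Lemma nrm_sub1_le a x : nrm a <= x -> nrm (1 - a) <= 1 + x.
Proof. by move=> ax; apply: le_trans (ler_nrmB _ _) _; rewrite nrm1 lerD2l. Qed.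

Lemma sub1_neq0 a : nrm a < 1 -> 1 - a != 0.
Proof. by apply: contraTneq => /subr0_eq <-; rewrite nrm1 ltxx. Qed.

Lemma nrm_mulX_lt1 a q n : nrm a < 1 -> nrm q < 1 -> nrm (a * q ^+ n) < 1.
Proof.
move=> a1 q1; have /andP[? ?] := nrm_expr_le n q1.
by rewrite nrmM nrmX (le_lt_trans _ a1) // ler_piMr // nrm_ge0.
Qed.

Lemma nrm_mul_lt1 a z : nrm a < 1 -> nrm z < 1 -> nrm (a * z) < 1.
Proof. by move=> a1 z1; have := nrm_mulX_lt1 1 a1 z1. Qed.

Lemma nrm_exp_lt1 z n : (0 < n)%N -> nrm z < 1 -> nrm (z ^+ n) < 1.
Proof. by move=> n0 z1; rewrite nrmX exprn_ilt1 ?nrm_ge0 // -lt0n. Qed.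

Lemma qpoch_neq0 a q n : nrm a < 1 -> nrm q < 1 -> qpoch a q n != 0.
Proof. by move=> a1 q1; apply/prodf_neq0 => j _; exact/sub1_neq0/nrm_mulX_lt1. Qed.

Lemma cvg_telescope_ratio (w : nat -> C) r N : 0 < r -> r < 1 ->
  ratio_bounded r N (fun n => w n.+1 - w n) -> cvgn w.
Proof.
move=> r0 r1 /(ratio_cvg r0 r1)/cvg_ex[l wl]; apply/cvg_ex; exists (w 0 + l).
rewrite [X in X @ _ --> _](_ : w = fun n => w 0 + series (fun n => w n.+1 - w n) n).
  by apply: cvgD; [exact: cvg_cst|exact: wl].
by apply/funext => n; rewrite /series /= telescope_sumr // addrC subrK.
Qed.

Lemma cvg_qpoch a q : nrm q < 1 -> qpoch a q n @[n --> \oo] --> qpoch_inf a q.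
Proof.
move=> q1; have [r0 r1 qr] := nrm_midpoint q1.
have : (fun n => nrm q * (1 + nrm a * nrm q ^+ n)) @ \oo --> nrm q * (1 + nrm a * 0).
  apply: cvgMl_tmp; apply: cvgD; first exact: cvg_cst.
  by apply: cvgMl_tmp; apply: cvg_expr; rewrite ger0_norm ?nrm_ge0.
rewrite mulr0 addr0 mulr1 => /cvg_eventually_le/(_ qr)[N _ bN].
apply: (cvg_telescope_ratio r0 r1 (N := N)) => n Nn.
rewrite !qpochSr.
have -> : qpoch a q n * (1 - a * q ^+ n) * (1 - a * q ^+ n.+1) -
  qpoch a q n * (1 - a * q ^+ n) =
  q * (1 - a * q ^+ n) * (qpoch a q n * (1 - a * q ^+ n) - qpoch a q n).
  by rewrite exprS; ring.
rewrite !nrmM ler_wpM2r ?nrm_ge0 // (le_trans _ (bN _ Nn)) //.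
by rewrite ler_wpM2l ?nrm_ge0 // nrm_sub1_le // nrmM nrmX.
Qed.

Arguments cvg_qpoch a {q} q1.

Lemma qpoch_inf_neq0 a q : nrm a < 1 -> nrm q < 1 -> qpoch_inf a q != 0.
Proof.
move=> a1 q1; have [r0 r1 qr] := nrm_midpoint q1.
have cq : (fun n => nrm q ^+ n) @ \oo --> (0 : R).
  by apply: cvg_expr; rewrite ger0_norm ?nrm_ge0.
have : (fun n => nrm q / (1 - nrm q ^+ n)) @ \oo --> nrm q / (1 - 0).
  apply: cvgMl_tmp; apply: cvgV; first by rewrite subr0 oner_neq0.
  by apply: cvgB; [exact: cvg_cst|exact: cq].
rewrite subr0 divr1 => /cvg_eventually_le/(_ qr)[N N0 bN].
have nz n := @qpoch_neq0 a q n a1 q1.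
have nz1 n : 1 - a * q ^+ n != 0 by exact/sub1_neq0/nrm_mulX_lt1.
have : cvgn (fun n => (qpoch a q n)^-1).
  apply: (cvg_telescope_ratio r0 r1 (N := N)) => n Nn.
  have -> : (qpoch a q n.+2)^-1 - (qpoch a q n.+1)^-1 =
    q / (1 - a * q ^+ n.+1) * ((qpoch a q n.+1)^-1 - (qpoch a q n)^-1).
    rewrite !qpochSr; have := nz1 n.+1; have := nz1 n; rewrite exprS => h1 h2.
    by field; rewrite nz h1 h2.
  rewrite nrmM ler_wpM2r ?nrm_ge0 // (le_trans _ (bN _ Nn)) // nrmM nrmV.
  rewrite ler_wpM2l ?nrm_ge0 // lef_pV2 ?posrE.
  - rewrite (le_trans _ (nrm_sub1_ge (x := nrm q ^+ n) _)) //.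
    rewrite nrmM nrmX exprS mulrA ler_piMl ?exprn_ge0 ?nrm_ge0 //.
    by rewrite mulr_ile1 ?nrm_ge0 // ltW.
  - by rewrite lt_neqAle nrm_ge0 eq_sym nrm_eq0 nz1.
  - by rewrite subr_gt0 exprn_ilt1 ?nrm_ge0 // -lt0n (leq_trans N0).
move=> /cvg_ex[l cl].
have h : (fun n => qpoch a q n * (qpoch a q n)^-1) @ \oo --> qpoch_inf a q * l.
  by apply: cvgM; [exact: cvg_qpoch|exact: cl].
rewrite (_ : (fun n => _) = cst 1) in h; last by apply/funext => n; rewrite /= mulfV.
have e : qpoch_inf a q * l = 1 := cvgC_unique h (cvg_cst (1 : C)).
by apply/eqP => z; have := oner_neq0 C; rewrite -e z mul0r eqxx.
Qed.

Lemma qpoch_double a q n : qpoch a q (2 * n) =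
  qpoch a (q ^+ 2) n * qpoch (a * q) (q ^+ 2) n.
Proof.
elim: n => [|n IHn]; first by rewrite muln0 !qpoch0 mulr1.
have -> : (2 * n.+1 = (2 * n).+2)%N by lia.
by rewrite !qpochSr IHn -exprM [q ^+ (2 * n).+1]exprS; ring.
Qed.

Lemma qpoch_opp a q n : qpoch a q n * qpoch (- a) q n = qpoch (a ^+ 2) (q ^+ 2) n.
Proof.
elim: n => [|n IHn]; first by rewrite !qpoch0 mulr1.
by rewrite !qpochSr -IHn -[q ^+ 2 ^+ n]exprM mulnC exprM; ring.
Qed.

Lemma qpoch_inf_double a q : nrm q < 1 ->
  qpoch_inf a q = qpoch_inf a (q ^+ 2) * qpoch_inf (a * q) (q ^+ 2).
Proof.
move=> q1; have q21 := @nrm_exp_lt1 q 2 isT q1.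
have double : (fun n => 2 * n)%N @ \oo --> \oo.
  move=> A [N _ NA]; exists N => // n /= Nn; apply: NA.
  by rewrite /= (leq_trans Nn) // leq_pmull.
apply: (cvgC_unique _ (cvgM (cvg_qpoch a q21) (cvg_qpoch (a * q) q21))).
under eq_cvg do rewrite /= -qpoch_double.
exact: (cvg_comp _ _ double (cvg_qpoch a q1)).
Qed.

Lemma qpoch_inf_opp a q : nrm q < 1 ->
  qpoch_inf a q * qpoch_inf (- a) q = qpoch_inf (a ^+ 2) (q ^+ 2).
Proof.
move=> q1; apply: (cvgC_unique (cvgM (cvg_qpoch a q1) (cvg_qpoch (- a) q1))).
under eq_cvg do rewrite /= qpoch_opp.
by apply: cvg_qpoch; exact: nrm_exp_lt1.
Qed.

Lemma qpoch_inf_rec a q : nrm q < 1 -> qpoch_inf a q = (1 - a) * qpoch_inf (a * q) q.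
Proof.
move=> q1; have := cvg_qpoch a q1; rewrite -cvg_shiftS.
move=> h; apply: (cvgC_unique h) => /=.
by under eq_cvg do rewrite qpochSl; apply: cvgMl_tmp; exact: cvg_qpoch.
Qed.

Arguments qpoch_inf_double a {q} q1.
Arguments qpoch_inf_rec a {q} q1.

Lemma euler_odd_distinct q : nrm q < 1 -> qpoch_inf (- q) q * qpoch_inf q (q ^+ 2) = 1.
Proof.
move=> q1; apply: (@mulfI _ (qpoch_inf q q)); first exact: qpoch_inf_neq0.
by rewrite mulrA qpoch_inf_opp // mulr1 mulrC [RHS]qpoch_inf_double // -expr2.
Qed.

Lemma iterate_funeq (A B F : C -> C) b q m :
  (forall j, A (b * q ^+ j) * F (b * q ^+ j) = B (b * q ^+ j) * F (b * q ^+ j.+1)) ->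
  (\prod_(j < m) A (b * q ^+ j)) * F b = (\prod_(j < m) B (b * q ^+ j)) * F (b * q ^+ m).
Proof.
move=> h; elim: m => [|m IHm]; first by rewrite !big_ord0 expr0 mulr1.
rewrite !big_ord_recr /= [LHS]mulrAC IHm mulrAC -[RHS]mulrA [in RHS]mulrC.
by rewrite -h; ring.
Qed.

Lemma hqpoch_shift b q n :
  hqpoch (b * q) q q n.+1 = q ^+ n.+1 * (b - 1) * hqpoch b q q n.
Proof.
elim: n => [|n IHn]; first by rewrite hqpochSr !hqpoch0; ring.
by rewrite hqpochSr IHn hqpochSr !exprS; ring.
Qed.

Lemma hqpoch_unit b q n :
  hqpoch q b q n.+1 = (q - b) * q ^+ n * qpoch b q n.
Proof.
elim: n => [|n IHn]; first by rewrite hqpochSr hqpoch0 qpoch0; ring.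
by rewrite hqpochSr IHn qpochSr !exprS; ring.
Qed.

Lemma hqpoch_dilate b q n : hqpoch q (b * q) q n = q ^+ n * qpoch b q n.
Proof.
elim: n => [|n IHn]; first by rewrite hqpoch0 qpoch0 mulr1.
by rewrite hqpochSr IHn qpochSr !exprS; ring.
Qed.

Definition psi_term q b n := hqpoch b q q n / qpoch b q n.+1.

Section WeightedSeries.
Variables (s : C) (x : nat -> C).
Hypotheses (x0 : x 0%N = 1) (x1 : x 1%N = s + 1).
Hypothesis x_rec : forall n, x n.+2 = s * x n.+1 - x n.

Lemma psi_term_partial_sum q b N : nrm q < 1 -> nrm b < 1 ->
  (1 - b) * (1 - s * b + b ^+ 2) * (\sum_(n < N.+1) x n * psi_term q b n)
  - (1 + b) * (1 - q * b ^+ 2) * (\sum_(n < N.+1) x n * psi_term q (b * q) n) =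
  (1 - b) * b * (x N * psi_term q b N.+1 - x N.+1 * psi_term q b N).
Proof.
move=> q1 b1.
have nz j : 1 - b * q ^+ j != 0 by exact/sub1_neq0/nrm_mulX_lt1.
have nzP n : qpoch b q n != 0 by exact: qpoch_neq0.
have nz0 := nz 0; have nz1 := nz 1; rewrite expr0 mulr1 in nz0; rewrite expr1 in nz1.
elim: N => [|N IHN].
  rewrite !big_ord1 /psi_term x0 x1 !hqpochSr !hqpoch0 !qpochSr !qpoch0.
  by rewrite expr0 expr1; field; rewrite nz0 nz1.
rewrite (big_ord_recr N.+1) [in X in _ - X](big_ord_recr N.+1) /=.
rewrite ![_ * (_ + _ * psi_term _ _ _)]mulrDr opprD addrACA IHN x_rec.
rewrite /psi_term hqpoch_shift.
have -> : qpoch (b * q) q N.+2 = qpoch b q N.+3 / (1 - b).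
  by rewrite [qpoch b q _]qpochSl mulrAC divff // mul1r.
have h1 := nz N; have h2 := nz N.+1; have h3 := nz N.+2.
rewrite !qpochSr !hqpochSr; move: h1 h2 h3; rewrite !exprS => h1 h2 h3.
by field; rewrite nz0 h1 h2 h3 nzP.
Qed.

Hypothesis x_growth : forall n, nrm (x n.+1) <= (1 + 2 * harmonic n) * nrm (x n).
Hypothesis x_mono : forall n, nrm (x n) <= nrm (x n.+1).

Lemma psi_term_ratio q (B : R) : nrm q < 1 -> B < 1 -> exists r N,
  [/\ 0 < r, r < 1 & forall b, nrm b <= B ->
      ratio_bounded r N (fun n => x n * psi_term q b n)].
Proof.
move=> q1 B1; have [Bneg|B0] := ltP B 0.
  exists 2^-1, 0%N; split; [lra|lra|move=> b bB n _].
  by have := nrm_ge0 b; lra.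
have cq : (fun n => nrm q ^+ n) @ \oo --> (0 : R).
  by apply: cvg_expr; rewrite ger0_norm ?nrm_ge0.
have : (fun n => (B + nrm q ^+ n) / (1 - nrm q ^+ n) * (1 + 2 * harmonic n)) @ \oo -->
    (B + 0) / (1 - 0) * (1 + 2 * 0).
  apply: cvgM.
    apply: cvgM; first by apply: cvgD; [exact: cvg_cst|exact: cq].
    apply: cvgV; first by rewrite subr0 oner_neq0.
    by apply: cvgB; [exact: cvg_cst|exact: cq].
  apply: cvgD; first exact: cvg_cst.
  by apply: cvgMl_tmp; exact: cvg_harmonic.
have Br : B < (1 + B) / 2 by lra.
rewrite mulr0 !addr0 subr0 divr1 mulr1 => /cvg_eventually_le/(_ Br)[N N0 bN].
exists ((1 + B) / 2), N; split; [lra|lra|move=> b bB n Nn].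
have b1 : nrm b < 1 by apply: le_lt_trans B1.
have nzb k : 1 - b * q ^+ k != 0 by exact/sub1_neq0/nrm_mulX_lt1.
have yn : nrm q ^+ n < 1 by rewrite exprn_ilt1 ?nrm_ge0 // -lt0n (leq_trans N0).
have y0 : 0 <= nrm q ^+ n by rewrite exprn_ge0 ?nrm_ge0.
have yS : nrm q ^+ n.+1 <= nrm q ^+ n by rewrite exprS ler_piMl // ltW.
rewrite /psi_term hqpochSr [qpoch b q n.+2]qpochSr -mulf_div !nrmM !nrmV.
set T := _ / nrm (qpoch _ _ _).
have T0 : 0 <= T by rewrite divr_ge0 ?nrm_ge0.
have c1 : nrm (b - q * q ^+ n) <= B + nrm q ^+ n.
  rewrite (le_trans (ler_nrmB _ _)) // lerD // -exprS nrmX //.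
have c2 : (nrm (1 - b * q ^+ n.+1))^-1 <= (1 - nrm q ^+ n)^-1.
  rewrite lef_pV2 ?posrE ?subr_gt0 //.
    apply: nrm_sub1_ge; rewrite nrmM nrmX (le_trans _ yS) // ler_piMl ?exprn_ge0 ?nrm_ge0 //.
    exact: ltW.
  by rewrite lt_neqAle nrm_ge0 eq_sym nrm_eq0 nzb.
apply: le_trans (_ : (1 + 2 * harmonic n) * nrm (x n) *
   (T * ((B + nrm q ^+ n) / (1 - nrm q ^+ n))) <= _).
  apply: ler_pM => //; rewrite ?nrm_ge0 //.
    by rewrite !mulr_ge0 ?invr_ge0 ?nrm_ge0.
  by rewrite ler_wpM2l // ler_pM ?invr_ge0 ?nrm_ge0.
have -> : (1 + 2 * harmonic n) * nrm (x n) * (T * ((B + nrm q ^+ n) / (1 - nrm q ^+ n))) =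
  (B + nrm q ^+ n) / (1 - nrm q ^+ n) * (1 + 2 * harmonic n) * (nrm (x n) * T) by ring.
by apply: ler_wpM2r; [rewrite mulr_ge0 ?nrm_ge0|exact: bN].
Qed.

Definition psi_sum q b := limn (series (fun n => x n * psi_term q b n)).

Lemma cvg_psi_sum q b : nrm q < 1 -> nrm b < 1 ->
  series (fun n => x n * psi_term q b n) @ \oo --> psi_sum q b.
Proof.
move=> q1 b1; have [r [N [r0 r1 /(_ b (lexx _)) rb]]] := psi_term_ratio q1 b1.
exact: (ratio_cvg r0 r1 rb).
Qed.

Lemma psi_sum_funeq q b : nrm q < 1 -> nrm b < 1 ->
  (1 - b) * (1 - s * b + b ^+ 2) * psi_sum q b =
  (1 + b) * (1 - q * b ^+ 2) * psi_sum q (b * q).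
Proof.
move=> q1 b1; have bq1 := nrm_mul_lt1 b1 q1.
have cb := cvg_psi_sum q1 b1; have cbq := cvg_psi_sum q1 bq1.
apply/eqP; rewrite -subr_eq0; apply/eqP.
have t0 : (fun n => x n * psi_term q b n) @ \oo --> (0 : C).
  by apply: cvg_series_cvg_0; exact: cvgP cb.
have /cvg_nrm nt0 := t0.
have bd1 : (fun N => x N * psi_term q b N.+1) @ \oo --> (0 : C).
  apply/cvg_nrm; move: nt0; rewrite -cvg_shiftS /=.
  under eq_cvg do rewrite subr0 nrmM; move=> nt.
  apply: (squeeze_cvgr _ (cvg_cst (0 : R)) nt); apply: nearW => N.
  by rewrite nrm_ge0 subr0 nrmM /= ler_wpM2r ?nrm_ge0.
have bd2 : (fun N => x N.+1 * psi_term q b N) @ \oo --> (0 : C).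
  apply/cvg_nrm.
  have nt : (fun n => 3 * nrm (x n * psi_term q b n - 0)) @ \oo --> (3 * 0 : R).
    exact: cvgMl_tmp.
  rewrite mulr0 in nt.
  apply: (squeeze_cvgr _ (cvg_cst (0 : R)) nt); apply: nearW => N.
  rewrite nrm_ge0 /= !subr0 (nrmM (x N.+1)) (nrmM (x N)) mulrA.
  apply: ler_wpM2r; first exact: nrm_ge0.
  rewrite (le_trans (x_growth _)) // ler_wpM2r ?nrm_ge0 //.
  have : harmonic N <= 1 :> R by rewrite /harmonic /= invf_le1 ?ler1n.
  lra.
rewrite -cvg_shiftS /= in cb; rewrite -cvg_shiftS /= in cbq.
have bd : (fun N =>
    (1 - b) * b * (x N * psi_term q b N.+1 - x N.+1 * psi_term q b N)) @ \oo -->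
    (1 - b) * b * (0 - 0) by apply: cvgMl_tmp; apply: cvgB; [exact: bd1|exact: bd2].
rewrite subr0 mulr0 in bd.
have part : (fun N =>
    (1 - b) * (1 - s * b + b ^+ 2) * series (fun n => x n * psi_term q b n) N.+1
  - (1 + b) * (1 - q * b ^+ 2) * series (fun n => x n * psi_term q (b * q) n) N.+1) @ \oo -->
  (1 - b) * (1 - s * b + b ^+ 2) * psi_sum q b -
  (1 + b) * (1 - q * b ^+ 2) * psi_sum q (b * q).
  by apply: cvgB; apply: cvgMl_tmp; [exact: cb|exact: cbq].
apply: (cvgC_unique part).
under eq_cvg do rewrite /series /= !big_mkord psi_term_partial_sum //.
exact: bd.
Qed.

Lemma psi_sum_limit q b : nrm q < 1 -> nrm b < 1 ->
  psi_sum q (b * q ^+ m) @[m --> \oo] --> psi_sum q 0.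
Proof.
move=> q1 b1; have [r [N [r0 r1 rb]]] := psi_term_ratio q1 b1.
apply: (ratio_tannery r0 r1 (N := N)) => [m|n].
  by apply: rb; rewrite nrmM nrmX ler_piMr ?nrm_ge0 //; case/andP: (nrm_expr_le m q1).
have cb : (fun m => b * q ^+ m) @ \oo --> (0 : C).
  by rewrite -(mulr0 b); apply: cvgMl_tmp; exact: cvg_exprC.
apply: cvgMl_tmp; apply: cvgM.
  elim: n => [|n IHn].
    by under eq_cvg do rewrite hqpoch0; rewrite hqpoch0; exact: cvg_cst.
  under eq_cvg do rewrite hqpochSr; rewrite hqpochSr; apply: cvgM; first exact: IHn.
  by apply: cvgB; [exact: cb|exact: cvg_cst].
apply: cvgV; first by apply: qpoch_neq0; rewrite ?nrm0.
elim: n.+1 => [|k IHk].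
  by under eq_cvg do rewrite qpoch0; rewrite qpoch0; exact: cvg_cst.
under eq_cvg do rewrite qpochSr; rewrite qpochSr; apply: cvgM; first exact: IHk.
by apply: cvgB; [exact: cvg_cst|apply: cvgMr_tmp; exact: cb].
Qed.

Lemma psi_sum_q q : nrm q < 1 -> psi_sum q q = (1 - q)^-1.
Proof.
move=> q1.
have e n : series (fun n => x n * psi_term q q n) n.+1 = (1 - q)^-1.
  rewrite /series /= big_mkord big_ord_recl big1 => [|k _].
    by rewrite /psi_term x0 hqpoch0 qpochSr qpoch0 expr0 mulr1 addr0 !mul1r.
  by rewrite /psi_term hqpoch_unit subrr !mul0r mulr0.
have := cvg_psi_sum q1 q1; rewrite -cvg_shiftS /= => h.
apply: (cvgC_unique h); rewrite (funext e).
exact: (cvg_cst ((1 - q)^-1 : C)).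
Qed.

End WeightedSeries.

Lemma prod_sub_sqr a q b m :
  \prod_(j < m) (1 - a * (b * q ^+ j) ^+ 2) = qpoch (a * b ^+ 2) (q ^+ 2) m.
Proof.
by apply: eq_bigr => j _; rewrite exprMn mulrA -!exprM mulnC.
Qed.

Section Alternating.
Variable q : C.
Hypothesis q1 : nrm q < 1.
Let x (n : nat) : C := (-1) ^+ n.

Let x_growth n : nrm (x n.+1) <= (1 + 2 * harmonic n) * nrm (x n).
Proof.
rewrite /x !nrmX nrmN nrm1 !expr1n mulr1 lerDl mulr_ge0 //; exact: harmonic_ge0.
Qed.

Let x_mono n : nrm (x n) <= nrm (x n.+1).
Proof. by rewrite /x !nrmX nrmN nrm1 !expr1n. Qed.

Lemma alternating_sum b : nrm b < 1 ->
  series (fun n => (-1) ^+ n * (hqpoch b q q n / qpoch b q n.+1)) @ \oo -->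
    qpoch_inf (q * b ^+ 2) (q ^+ 2) * qpoch_inf (- q) q
    * qpoch_inf (q ^+ 2) (q ^+ 2) / qpoch_inf (b ^+ 2) (q ^+ 2).
Proof.
move=> b1.
have x1 : x 1 = -2 + 1 by rewrite /x expr1; ring.
have x_rec n : x n.+2 = -2 * x n.+1 - x n by rewrite /x !exprS; ring.
have q21 : nrm (q ^+ 2) < 1 by exact: nrm_exp_lt1.
have main z : nrm z < 1 ->
    qpoch_inf (z ^+ 2) (q ^+ 2) * psi_sum x q z =
    qpoch_inf (q * z ^+ 2) (q ^+ 2) * psi_sum x q 0.
  move=> z1.
  have step m : qpoch (z ^+ 2) (q ^+ 2) m * psi_sum x q z =
      qpoch (q * z ^+ 2) (q ^+ 2) m * psi_sum x q (z * q ^+ m).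
    have := @iterate_funeq (fun z => 1 - 1 * z ^+ 2)
      (fun z => 1 - q * z ^+ 2) (psi_sum x q) z q m.
    rewrite !prod_sub_sqr mul1r; apply => j; have zj := nrm_mulX_lt1 j z1 q1.
    apply: (@mulfI _ (1 + z * q ^+ j)).
      by rewrite -[z * _]opprK sub1_neq0 // nrmN.
    have := psi_sum_funeq (erefl : x 0 = 1) x1 x_rec x_growth x_mono q1 zj.
    rewrite [z * q ^+ j.+1](_ : _ = z * q ^+ j * q); last by rewrite exprSr mulrA.
    move: (z * q ^+ j) => w e.
    transitivity ((1 - w) * (1 - -2 * w + w ^+ 2) * psi_sum x q w); first by ring.
    by rewrite e; ring.
  apply: (cvgC_unique _ (cvgM (cvg_qpoch _ q21) (psi_sum_limit x_growth q1 z1))).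
  rewrite /=; under eq_cvg do rewrite /= -step.
  by apply: cvgMr_tmp; exact: cvg_qpoch.
have E0 : psi_sum x q 0 = qpoch_inf (- q) q * qpoch_inf (q ^+ 2) (q ^+ 2).
  have := main q q1; rewrite (psi_sum_q (erefl : x 0 = 1) x_growth q1).
  have := euler_odd_distinct q1.
  rewrite (qpoch_inf_rec q q21) -exprS => e E.
  have nz := sub1_neq0 q1.
  have {}E : qpoch_inf (q ^+ 2) (q ^+ 2) =
      (1 - q) * qpoch_inf (q ^+ 3) (q ^+ 2) * psi_sum x q 0.
    by rewrite -mulrA -E mulrC divfK.
  by rewrite E mulrA e mul1r.
have nz : qpoch_inf (b ^+ 2) (q ^+ 2) != 0.
  by apply: qpoch_inf_neq0 => //; exact: nrm_exp_lt1.
have -> : qpoch_inf (q * b ^+ 2) (q ^+ 2) * qpoch_inf (- q) q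
    * qpoch_inf (q ^+ 2) (q ^+ 2) / qpoch_inf (b ^+ 2) (q ^+ 2) = psi_sum x q b.
  by apply: (mulfI nz); rewrite (main b b1) E0 [LHS]mulrC divfK // mulrA.
exact: (cvg_psi_sum x_growth q1 b1).
Qed.

End Alternating.

Section OddWeights.
Variable q : C.
Hypothesis q1 : nrm q < 1.
Let x (n : nat) : C := (2 * n + 1)%:R.

Let x_growth n : nrm (x n.+1) <= (1 + 2 * harmonic n) * nrm (x n).
Proof.
rewrite /x !nrm_natr /harmonic /= mulrDl mul1r.
have -> : (2 * n.+1 + 1)%:R = (2 * n + 1)%:R + 2 :> R by rewrite -natrD; congr (_%:R); lia.
rewrite lerD2l -mulrA ler_pMr // mulrC ler_pdivlMr // mul1r ler_nat; lia.
Qed.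

Let x_mono n : nrm (x n) <= nrm (x n.+1).
Proof. by rewrite /x !nrm_natr ler_nat; lia. Qed.

Lemma odd_weight_sum b : nrm b < 1 ->
  series (fun n => (2 * n + 1)%:R * (hqpoch b q q n / qpoch b q n.+1)) @ \oo -->
    qpoch_inf (b ^+ 2) q * qpoch_inf q q ^+ 3 / qpoch_inf b q ^+ 4.
Proof.
move=> b1.
have x1 : x 1 = 2 + 1 by rewrite /x muln1 natrD.
have x_rec n : x n.+2 = 2 * x n.+1 - x n.
  rewrite /x (_ : 2 * n.+2 + 1 = (2 * n + 1) + 4)%N; last by lia.
  by rewrite (_ : 2 * n.+1 + 1 = (2 * n + 1) + 2)%N; [rewrite !natrD; ring|lia].
have q21 : nrm (q ^+ 2) < 1 by exact: nrm_exp_lt1.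
have main z : nrm z < 1 ->
    qpoch_inf z q ^+ 4 * psi_sum x q z = qpoch_inf (z ^+ 2) q * psi_sum x q 0.
  move=> z1.
  have step m : qpoch z q m ^+ 4 * psi_sum x q z =
      qpoch (z ^+ 2) (q ^+ 2) m * qpoch (q * z ^+ 2) (q ^+ 2) m * psi_sum x q (z * q ^+ m).
    have := @iterate_funeq (fun z => (1 - z) ^+ 4)
      (fun z => (1 - 1 * z ^+ 2) * (1 - q * z ^+ 2)) (psi_sum x q) z q m.
    rewrite prodrXl big_split /= !prod_sub_sqr mul1r; apply => j.
    have zj := nrm_mulX_lt1 j z1 q1.
    have := psi_sum_funeq (erefl : x 0 = 1) x1 x_rec x_growth x_mono q1 zj.
    rewrite [z * q ^+ j.+1](_ : _ = z * q ^+ j * q); last by rewrite exprSr mulrA.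
    move: (z * q ^+ j) => w /(congr1 (fun y => (1 - w) * y)) e.
    transitivity ((1 - w) * ((1 - w) * (1 - 2 * w + w ^+ 2) * psi_sum x q w)); first by ring.
    by rewrite e; ring.
  rewrite (qpoch_inf_double (z ^+ 2) q1) [z ^+ 2 * q]mulrC.
  apply: (cvgC_unique _ (cvgM (cvgM (cvg_qpoch _ q21) (cvg_qpoch _ q21))
    (psi_sum_limit x_growth q1 z1))).
  rewrite /=; under eq_cvg do rewrite /= -step.
  by apply: cvgMr_tmp; apply: cvg_expn; exact: cvg_qpoch.
have nzq := qpoch_inf_neq0 q1 q1.
have E0 : psi_sum x q 0 = qpoch_inf q q ^+ 3.
  have := main q q1; rewrite (psi_sum_q (erefl : x 0 = 1) x_growth q1).
  have nz := sub1_neq0 q1.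
  rewrite [q ^+ 2](exprS q 1) expr1 => e.
  have {}e : qpoch_inf q q ^+ 4 = qpoch_inf q q * psi_sum x q 0.
    by rewrite [in RHS]qpoch_inf_rec // -mulrA -e mulrC divfK.
  by apply: (mulfI nzq); rewrite -e exprS.
have nz : qpoch_inf b q ^+ 4 != 0 by rewrite expf_neq0 // qpoch_inf_neq0.
have -> : qpoch_inf (b ^+ 2) q * qpoch_inf q q ^+ 3 / qpoch_inf b q ^+ 4 = psi_sum x q b.
  by apply: (mulfI nz); rewrite (main b b1) E0 [LHS]mulrC divfK.
exact: (cvg_psi_sum x_growth q1 b1).
Qed.

End OddWeights.
End InfiniteProducts.

Arguments cvg_qpoch [R] a [q] q1.
Arguments qpoch_inf_rec [R] a [q] q1.

Section WellPoisedSeries.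
Variable R : realType.
Local Notation C := (Cplx R).
Implicit Types b q z : C.

Definition wp_term q b n : C :=
  (-1) ^+ n * (hqpoch q b q n * qpoch b q n * qpoch q (q ^+ 2) n
     * (1 - b * q ^+ (2 * n))
     / (qpoch q q n * qpoch q q n.+1 * qpoch (b ^+ 2 * q) (q ^+ 2) n)).

Lemma wp_term_rec q b n : nrm q < 1 -> nrm b < 1 -> wp_term q b n.+1 =
  - ((q - b * q ^+ n) * (1 - b * q ^+ n) * (1 - q * q ^+ (2 * n)) * (1 - b * q ^+ (2 * n.+1))
   / ((1 - b * q ^+ (2 * n)) * (1 - q * q ^+ n) * (1 - q * q ^+ n.+1)
      * (1 - b ^+ 2 * q * q ^+ (2 * n)))) * wp_term q b n.
Proof.
move=> q1 b1; rewrite /wp_term.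
have q21 := @nrm_exp_lt1 R q 2 isT q1.
have b21 : nrm (b ^+ 2 * q) < 1 by apply: nrm_mul_lt1 => //; exact: nrm_exp_lt1.
have nzq j : qpoch q q j != 0 by exact: qpoch_neq0.
have nzb j : qpoch (b ^+ 2 * q) (q ^+ 2) j != 0 by exact: qpoch_neq0.
have nz1 j : 1 - b * q ^+ j != 0 by exact/sub1_neq0/nrm_mulX_lt1.
have nz2 j : 1 - q * q ^+ j != 0 by exact/sub1_neq0/nrm_mulX_lt1.
have nz3 : 1 - b ^+ 2 * q * q ^+ (2 * n) != 0 by exact/sub1_neq0/nrm_mulX_lt1.
rewrite (qpochSr q q n.+1) hqpochSr !(qpochSr _ _ n) -!exprM.
have := nz1 (2 * n)%N; have := nz2 n; have := nz2 n.+1; have := nz3.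
move: (nzq n) (nzb n).
move: (q ^+ (2 * n.+1)) (q ^+ (2 * n)) (q ^+ n.+1) (q ^+ n) => A B D E.
move: (qpoch _ _ _) (qpoch _ _ _) (hqpoch _ _ _ _) (qpoch _ _ _) (qpoch _ _ _)
  => P1 P2 P3 P4 P5.
move=> h1 h2 h3 h4 h5 h6.
rewrite exprS; field.
by rewrite h1 h2 h3 h4 h5 h6.
Qed.

Lemma wp_term_ratio q : nrm q < 1 -> exists r N,
  [/\ 0 < r, r < 1 & forall b, nrm b < 1 -> ratio_bounded r N (wp_term q b)].
Proof.
move=> q1; have [r0 r1 qr] := nrm_midpoint q1.
have cq : (fun n => nrm q ^+ n) @ \oo --> (0 : R).
  by apply: cvg_expr; rewrite ger0_norm ?nrm_ge0.
have : (fun n =>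
    (nrm q + nrm q ^+ n) * (1 + nrm q ^+ n) * (1 + nrm q ^+ n) * (1 + nrm q ^+ n) /
    ((1 - nrm q ^+ n) * (1 - nrm q ^+ n) * (1 - nrm q ^+ n) * (1 - nrm q ^+ n))) @ \oo -->
    (nrm q + 0) * (1 + 0) * (1 + 0) * (1 + 0) / ((1 - 0) * (1 - 0) * (1 - 0) * (1 - 0)).
  have c1 : (fun n => 1 + nrm q ^+ n) @ \oo --> 1 + (0 : R).
    by apply: cvgD; [exact: cvg_cst|exact: cq].
  have c2 : (fun n => 1 - nrm q ^+ n) @ \oo --> 1 - (0 : R).
    by apply: cvgB; [exact: cvg_cst|exact: cq].
  apply: cvgM.
    apply: cvgM; last exact: c1.
    apply: cvgM; last exact: c1.
    apply: cvgM; last exact: c1.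
    by apply: cvgD; [exact: cvg_cst|exact: cq].
  apply: cvgV; first by rewrite subr0 !mulr1 oner_neq0.
  by apply: cvgM; [apply: cvgM; [apply: cvgM|]|]; exact: c2.
rewrite !addr0 subr0 !mulr1 divr1 => /cvg_eventually_le/(_ qr)[N N0 bN].
exists ((1 + nrm q) / 2), N; split=> // b b1 n Nn.
rewrite wp_term_rec // nrmM nrmN; apply: ler_wpM2r; first exact: nrm_ge0.
apply: le_trans (bN n Nn).
set y := nrm q ^+ n.
have y1 : y < 1 by rewrite exprn_ilt1 ?nrm_ge0 // -lt0n (leq_trans N0).
have y0 : 0 <= y by rewrite exprn_ge0 ?nrm_ge0.
have by_ a k : nrm a <= 1 -> (n <= k)%N -> nrm (a * q ^+ k) <= y.
  move=> a1 nk; rewrite nrmM nrmX (le_trans (_ : _ <= nrm q ^+ k)) //.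
    by rewrite ler_piMl ?exprn_ge0 ?nrm_ge0.
  by rewrite ler_wiXn2l ?nrm_ge0 ?ltW.
have b1' := ltW b1; have q1' := ltW q1.
have b21 : nrm (b ^+ 2 * q) <= 1 by apply/ltW/nrm_mul_lt1 => //; exact: nrm_exp_lt1.
have n2 : (n <= 2 * n)%N by rewrite leq_pmull.
have n2' : (n <= 2 * n.+1)%N by rewrite (leq_trans (leqnSn n)) // leq_pmull.
rewrite !nrmM nrmV !nrmM.
apply: ler_pM; rewrite ?invr_ge0 ?mulr_ge0 ?nrm_ge0 //.
  do 3! (apply: ler_pM; rewrite ?mulr_ge0 ?nrm_ge0 //; last by rewrite nrm_sub1_le // by_).
  by rewrite (le_trans (ler_nrmB _ _)) // lerD // by_.
have ge a k : nrm a <= 1 -> (n <= k)%N -> 1 - y <= nrm (1 - a * q ^+ k).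
  by move=> a1 nk; rewrite nrm_sub1_ge // by_.
have y1' : 0 < 1 - y by rewrite subr_gt0.
have gt a k : nrm a <= 1 -> (n <= k)%N -> 0 < nrm (1 - a * q ^+ k).
  by move=> a1 nk; rewrite (lt_le_trans y1') // ge.
rewrite lef_pV2 ?posrE ?mulr_gt0 ?gt //.
by do 3! (apply: ler_pM; rewrite ?mulr_ge0 ?(ltW y1') ?ge //).
Qed.

Definition wp_sum q b := limn (series (wp_term q b)).

Lemma cvg_wp_sum q b : nrm q < 1 -> nrm b < 1 -> series (wp_term q b) @ \oo --> wp_sum q b.
Proof.
move=> q1 b1; have [r [N [r0 r1 /(_ b b1) rb]]] := wp_term_ratio q1.
exact: (ratio_cvg r0 r1 rb).
Qed.

Lemma wp_sum_limit q b : nrm q < 1 -> nrm b < 1 ->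
  wp_sum q (b * q ^+ m) @[m --> \oo] --> wp_sum q 0.
Proof.
move=> q1 b1; have [r [N [r0 r1 rb]]] := wp_term_ratio q1.
apply: (ratio_tannery r0 r1 (N := N)) => [m|n]; first exact/rb/nrm_mulX_lt1.
have cb : (fun m => b * q ^+ m) @ \oo --> (0 : C).
  by rewrite -(mulr0 b); apply: cvgMl_tmp; exact: cvg_exprC.
have q21 := @nrm_exp_lt1 R q 2 isT q1.
have cP (p : C) (f : nat -> C) k : f @ \oo --> (0 : C) ->
    qpoch (f m) p k @[m --> \oo] --> qpoch 0 p k.
  move=> cf; elim: k => [|k IHk].
    by under eq_cvg do rewrite qpoch0; rewrite qpoch0; exact: cvg_cst.
  under eq_cvg do rewrite qpochSr; rewrite qpochSr; apply: cvgM; first exact: IHk.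
  by apply: cvgB; [exact: cvg_cst|apply: cvgMr_tmp; exact: cf].
apply: cvgMl_tmp; apply: cvgM.
  apply: cvgM; last by apply: cvgB; [exact: cvg_cst|apply: cvgMr_tmp; exact: cb].
  apply: cvgMr_tmp; apply: cvgM; last exact: cP.
  elim: n => [|n IHn].
    by under eq_cvg do rewrite hqpoch0; rewrite hqpoch0; exact: cvg_cst.
  under eq_cvg do rewrite hqpochSr; rewrite hqpochSr; apply: cvgM; first exact: IHn.
  by apply: cvgB; [exact: cvg_cst|apply: cvgMr_tmp; exact: cb].
apply: cvgV.
  by rewrite !mulf_neq0 //; apply: qpoch_neq0; rewrite // expr2 !mul0r nrm0.
apply: cvgMl_tmp.
have c2 : (fun m => (b * q ^+ m) ^+ 2 * q) @ \oo --> (0 : C).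
  by rewrite -(mul0r q) -(mulr0 0); apply: cvgMr_tmp; apply: cvgM; exact: cb.
by rewrite [0 ^+ 2 * q](_ : _ = 0); [exact: cP|rewrite expr2 !mul0r].
Qed.

Definition wp_partial q b N : C :=
  (1 - q * b ^+ 2) * b * (-1) ^+ N.+1 * q ^+ N
  * (qpoch b q N * qpoch b q N.+1 * qpoch q (q ^+ 2) N.+1
     / (qpoch q q N * qpoch q q N.+1 * qpoch (b ^+ 2 * q) (q ^+ 2) N.+1)).

Lemma wp_term_partial_sum q b N : nrm q < 1 -> nrm b < 1 ->
  (1 - q * b ^+ 2) * (\sum_(n < N.+1) wp_term q b n)
  - (1 - b ^+ 2) * (\sum_(n < N.+1) wp_term q (b * q) n) = wp_partial q b N.
Proof.
move=> q1 b1.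
have q21 := @nrm_exp_lt1 R q 2 isT q1.
have b21 : nrm (b ^+ 2 * q) < 1 by apply: nrm_mul_lt1 => //; exact: nrm_exp_lt1.
have nzq j : qpoch q q j != 0 by exact: qpoch_neq0.
have nzb j : qpoch (b ^+ 2 * q) (q ^+ 2) j != 0 by exact: qpoch_neq0.
have nz2 j : 1 - q * q ^+ j != 0 by exact/sub1_neq0/nrm_mulX_lt1.
have nz3 j : 1 - b ^+ 2 * q * q ^+ 2 ^+ j != 0 by exact/sub1_neq0/nrm_mulX_lt1.
have nb := sub1_neq0 b1.
have nb2 := sub1_neq0 b21.
have nq := sub1_neq0 q1.
elim: N => [|N IHN].
  rewrite !big_ord1 /wp_term /wp_partial !qpochSr !hqpoch0 !qpoch0.
  rewrite !muln0 !expr0 !expr1 !mulr1 !mul1r.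
  by field; rewrite nq nb2.
rewrite (big_ord_recr N.+1) [in X in _ - X](big_ord_recr N.+1) /=.
rewrite ![_ * (_ + wp_term _ _ _)]mulrDr opprD addrACA {}IHN.
rewrite /wp_term /wp_partial hqpoch_unit hqpoch_dilate.
have -> : qpoch (b * q) q N.+1 = qpoch b q N.+2 / (1 - b).
  by rewrite [qpoch b q _]qpochSl mulrAC divff // mul1r.
have -> : qpoch ((b * q) ^+ 2 * q) (q ^+ 2) N.+1 =
    qpoch (b ^+ 2 * q) (q ^+ 2) N.+2 / (1 - b ^+ 2 * q).
  rewrite [qpoch (b ^+ 2 * q) _ _]qpochSl [RHS]mulrAC divff // mul1r.
  by congr qpoch; ring.
have h1 := nz2 N; have h2 := nz2 N.+1; have h3 := nz3 N; have h4 := nz3 N.+1.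
move: h1 h2 h3 h4; rewrite !qpochSr mulnS exprD -!exprM.
have -> : q ^+ (2 * N.+1) = q ^+ 2 * q ^+ N * q ^+ N
  by rewrite -!exprD; congr (_ ^+ _); lia.
have -> : q ^+ (2 * N) = q ^+ N * q ^+ N
  by rewrite -!exprD; congr (_ ^+ _); lia.
rewrite ![_ ^+ N.+1]exprS ![_ ^+ N.+2]exprS ![_ ^+ N.+1]exprS.
move: (nzq N) (nzb N); move: (q ^+ N) (qpoch _ _ _) (qpoch _ _ _) => Q P1 P2.
move: (qpoch _ _ _) (qpoch _ _ _) ((-1) ^+ N) => P3 P4 e => h1 h2 h3 h4 h5 h6.
field.
by rewrite h1 h2 h3 h4 h5 h6 nb nb2.
Qed.

Lemma wp_sum_funeq q b : nrm q < 1 -> nrm b < 1 ->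
  (1 - q * b ^+ 2) * wp_sum q b = (1 - b ^+ 2) * wp_sum q (b * q).
Proof.
move=> q1 b1; have bq1 := nrm_mul_lt1 b1 q1.
have q21 := @nrm_exp_lt1 R q 2 isT q1.
have b21 : nrm (b ^+ 2 * q) < 1 by apply: nrm_mul_lt1 => //; exact: nrm_exp_lt1.
have shift (u : nat -> C) (l : C) : u @ \oo --> l -> (fun n => u n.+1) @ \oo --> l.
  by move=> ul; rewrite cvg_shiftS.
have bd : wp_partial q b @ \oo --> (0 : C).
  have c0 : (fun N => (1 - q * b ^+ 2) * b * (-1) ^+ N.+1 * q ^+ N) @ \oo --> (0 : C).
    apply/cvg_nrm; have h : (fun N => nrm q ^+ N) @ \oo --> (0 : R).
      by apply: cvg_expr; rewrite ger0_norm ?nrm_ge0.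
    have {}h : (fun N => nrm ((1 - q * b ^+ 2) * b) * nrm q ^+ N) @ \oo -->
      nrm ((1 - q * b ^+ 2) * b) * 0 by exact: cvgMl_tmp.
    rewrite mulr0 in h.
    under eq_cvg do rewrite subr0 (nrmM _ (q ^+ _)) (nrmM _ ((-1) ^+ _))
      (nrmX (-1)) (nrmX q) nrmN nrm1 expr1n mulr1.
    exact: h.
  have nz1 := qpoch_inf_neq0 q1 q1.
  have nz2 := qpoch_inf_neq0 b21 q21.
  suff : wp_partial q b @ \oo --> (0 * (qpoch_inf b q * qpoch_inf b q * qpoch_inf q (q ^+ 2)
     / (qpoch_inf q q * qpoch_inf q q * qpoch_inf (b ^+ 2 * q) (q ^+ 2))) : C).
    by rewrite mul0r.
  apply: cvgM; first exact: c0.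
  apply: cvgM.
    apply: cvgM; last by apply: shift; exact: cvg_qpoch.
    by apply: cvgM; [|apply: shift]; exact: cvg_qpoch.
  apply: cvgV; first by rewrite !mulf_neq0.
  apply: cvgM; last by apply: shift; exact: cvg_qpoch.
  by apply: cvgM; [|apply: shift]; exact: cvg_qpoch.
apply/eqP; rewrite -subr_eq0; apply/eqP.
have cb := shift _ _ (cvg_wp_sum q1 b1); have cbq := shift _ _ (cvg_wp_sum q1 bq1).
have part : (fun N => (1 - q * b ^+ 2) * series (wp_term q b) N.+1
  - (1 - b ^+ 2) * series (wp_term q (b * q)) N.+1) @ \oo -->
  (1 - q * b ^+ 2) * wp_sum q b - (1 - b ^+ 2) * wp_sum q (b * q).
  by apply: cvgB; apply: cvgMl_tmp; [exact: cb|exact: cbq].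
apply: (cvgC_unique part).
under eq_cvg do rewrite /series /= !big_mkord wp_term_partial_sum //.
exact: bd.
Qed.

Lemma wp_sum_q q : nrm q < 1 -> wp_sum q q = 1.
Proof.
move=> q1; have nq := sub1_neq0 q1.
have e n : series (wp_term q q) n.+1 = 1.
  rewrite /series /= big_mkord big_ord_recl big1 => [|k _].
    rewrite /wp_term /= hqpoch0 qpochSr !qpoch0 muln0 !expr0 !mulr1 !mul1r addr0.
    by rewrite divff.
  by rewrite /wp_term hqpoch_unit subrr !(mul0r, mulr0).
have := cvg_wp_sum q1 q1; rewrite -cvg_shiftS /= => h.
by apply: (cvgC_unique h); rewrite (funext e); exact: (cvg_cst (1 : C)).
Qed.

Lemma well_poised_sum q b : nrm q < 1 -> nrm b < 1 ->
  series (wp_term q b) @ \oo -->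
    qpoch_inf (b ^+ 2) (q ^+ 2)
    / (qpoch_inf (q * b ^+ 2) (q ^+ 2) * qpoch_inf (- q) q
       * qpoch_inf (q ^+ 2) (q ^+ 2) * (1 - q)).
Proof.
move=> q1 b1; have q21 : nrm (q ^+ 2) < 1 by exact: nrm_exp_lt1.
have main z : nrm z < 1 ->
    qpoch_inf (q * z ^+ 2) (q ^+ 2) * wp_sum q z =
    qpoch_inf (z ^+ 2) (q ^+ 2) * wp_sum q 0.
  move=> z1.
  have step m : qpoch (q * z ^+ 2) (q ^+ 2) m * wp_sum q z =
      qpoch (z ^+ 2) (q ^+ 2) m * wp_sum q (z * q ^+ m).
    have := @iterate_funeq R (fun z => 1 - q * z ^+ 2)
      (fun z => 1 - 1 * z ^+ 2) (wp_sum q) z q m.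
    rewrite !prod_sub_sqr mul1r; apply => j; have zj := nrm_mulX_lt1 j z1 q1.
    rewrite [z * q ^+ j.+1](_ : _ = z * q ^+ j * q); last by rewrite exprSr mulrA.
    by rewrite [1 * _]mul1r; exact: wp_sum_funeq.
  apply: (cvgC_unique _ (cvgM (cvg_qpoch _ q21) (wp_sum_limit q1 z1))).
  rewrite /=; under eq_cvg do rewrite /= -step.
  by apply: cvgMr_tmp; exact: cvg_qpoch.
have nz := sub1_neq0 q1.
have nz2 := qpoch_inf_neq0 q21 q21.
have b21 : nrm (b ^+ 2) < 1 by exact: nrm_exp_lt1.
have nzb := qpoch_inf_neq0 (nrm_mul_lt1 q1 b21) q21.
have nzo : qpoch_inf (- q) q != 0 by rewrite qpoch_inf_neq0 // nrmN.
have E0 : qpoch_inf (- q) q * qpoch_inf (q ^+ 2) (q ^+ 2) * (1 - q) * wp_sum q 0 = 1.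
  have := main q q1; rewrite wp_sum_q // [LHS]mulr1 => E.
  have := euler_odd_distinct q1.
  rewrite (qpoch_inf_rec q q21) E => e; rewrite -[RHS]e.
  by move: (qpoch_inf (- q) q) (qpoch_inf (q ^+ 2) (q ^+ 2)) (wp_sum q 0) => X Y Z; ring.
suff <- : wp_sum q b = qpoch_inf (b ^+ 2) (q ^+ 2)
    / (qpoch_inf (q * b ^+ 2) (q ^+ 2) * qpoch_inf (- q) q
       * qpoch_inf (q ^+ 2) (q ^+ 2) * (1 - q)) by exact: cvg_wp_sum.
apply: (mulfI nzb); rewrite (main b b1).
transitivity (qpoch_inf (b ^+ 2) (q ^+ 2) /
    (qpoch_inf (- q) q * qpoch_inf (q ^+ 2) (q ^+ 2) * (1 - q))); last first.
  move: nzb nzo nz2; move: (qpoch_inf (b ^+ 2) _) (qpoch_inf (q * b ^+ 2) _).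
  move: (qpoch_inf (- q) q) (qpoch_inf (q ^+ 2) (q ^+ 2)) => X Y Z W h1 h2 h3.
  by field; rewrite h1 h2 h3 nz.
have D0 : qpoch_inf (- q) q * qpoch_inf (q ^+ 2) (q ^+ 2) * (1 - q) != 0.
  by apply: mulf_neq0 nz; exact: mulf_neq0 nzo nz2.
move: D0 E0; move: (_ * (1 - q)) (wp_sum q 0) => D u D0 E0.
by congr (_ * _); apply: (mulfI D0); rewrite E0 mulfV.
Qed.

End WellPoisedSeries.

Theorem theorem6 (R : realType) :
  (* (i) *)
  (forall (n : nat) (q b : Cplx R),
     (1 <= n)%N -> q != 1 -> (forall j : nat, b * q ^+ j != 1) ->
     0 = \sum_(k < n.+1)
           ratval (qbin 'X n k * qbin 'X (n + k) k) (1 - 'X^(k.+1)) q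
           * (hqpoch q b q k * hqpoch b q q (n - k))
           * ((1 - b * q ^+ (2 * k)) / qpoch (b * q ^+ k) q n.+1)
     /\
     0 = \sum_(k < n.+1)
           qbin q (2 * n + 1) (n - k)
           * (hqpoch b q q k * hqpoch q b q (n - k))
           * (1 - q ^+ (2 * k + 1)) * qpoch (b * q ^+ k.+1) q (n - 1))
  /\
  (* (ii) *)
  (forall q b : Cplx R, `|q| < 1 -> `|b| < 1 ->
     [/\ series (fun n : nat =>
           (-1) ^+ n * (hqpoch b q q n / qpoch b q n.+1)) @ \oo -->
         qpoch_inf (q * b ^+ 2) (q ^+ 2) * qpoch_inf (- q) q
         * qpoch_inf (q ^+ 2) (q ^+ 2) / qpoch_inf (b ^+ 2) (q ^+ 2),
         series (fun n : nat =>
           (-1) ^+ n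
           * (hqpoch q b q n * qpoch b q n * qpoch q (q ^+ 2) n
              * (1 - b * q ^+ (2 * n))
              / (qpoch q q n * qpoch q q n.+1
                 * qpoch (b ^+ 2 * q) (q ^+ 2) n))) @ \oo -->
         (* no factor (1 - b)^2 on this side: for b = q the series reduces to
            its term n = 0, and both sides are equal to 1 *)
         qpoch_inf (b ^+ 2) (q ^+ 2)
         / (qpoch_inf (q * b ^+ 2) (q ^+ 2) * qpoch_inf (- q) q
            * qpoch_inf (q ^+ 2) (q ^+ 2) * (1 - q))
       & series (fun n : nat =>
           (2 * n + 1)%:R * (hqpoch b q q n / qpoch b q n.+1)) @ \oo -->
         qpoch_inf (b ^+ 2) q * qpoch_inf q q ^+ 3 / qpoch_inf b q ^+ 4]).
Proof.
split=> [n q b n1 q1 bq|q b].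
  by split; symmetry; [exact: qcat_sum_eq0|exact: odd_bin_sum_eq0].
rewrite !nrm_lt1 => q1 b1; split.
- exact: alternating_sum.
- exact: well_poised_sum.
- exact: odd_weight_sum.
Qed.
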